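(* For all positive integers $m$ and $p$, $$(-1)^m \sum_{j=1}^p W(2j+2m-3,2m-1)\,Z(j,p)=(-1)^p \sum_{j=1}^m W(2j+2p-3,2p-1)\,Z(j,m).$$
   Context: For positive integers $k_1,\dots,k_r$ the alternating multiple $T$-value is $\bar T(k_1,\ldots,k_r):=2^r\sum_{0<n_1<\cdots<n_r}\frac{(-1)^{n_r}}{(2n_1-1)^{k_1}(2n_2-2)^{k_2}\cdots(2n_r-r)^{k_r}}$ (conditionally convergent series), with $\bar T(\emptyset):=1$. $I(k,r)$ denotes the set of tuples $(k_1,\dots,k_r)$ of positive integers with $k_1+\cdots+k_r=k$. $W(k,r):=\sum_{(k_1,\dots,k_r)\in I(k,r)}\bar T(k_1,\dots,k_r)$. $\bar\zeta(s):=\sum_{n\ge1}(-1)^{n-1}n^{-s}$ for integers $s\ge1$, and $\bar\zeta(0):=1/2$. For integers $1\le j\le p$: $Z(p,p):=1$ and, for $j<p$, $Z(j,p):=\sum_{k=1}^{p-j}(-2)^k\sum_{j=i_0<i_1<\cdots<i_{k-1}<i_k=p}\ \prod_{l=1}^k\bar\zeta(2i_l-2i_{l-1})$. *)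

(* Defs.v *)
From HB Require Import structures.
From mathcomp Require Import all_boot all_order all_algebra.
From mathcomp Require Import all_classical all_reals all_analysis.
Set Implicit Arguments. Unset Strict Implicit. Unset Printing Implicit Defensive.
Import Order.TTheory GRing.Theory Num.Theory.
Import numFieldNormedType.Exports.
Local Open Scope ring_scope.

Section Defs.
Variable R : realType.

(* Inner (finite) part of the alternating multiple T-value, for fixed largest
   index n_r = n, with r = size ks >= 1:
   sum over 0 < n_1 < ... < n_{r-1} < n of
   prod_{i=1}^r 1 / (2 n_i - i)^{k_i}. *)
Definition Tbar_inner (ks : seq nat) (n : nat) : R :=
  \sum_(t : (size ks).-1.-tuple 'I_n | sorted ltn (0%N :: map val t))
    let ns := rcons (map val t) n in
    \prod_(i < size ks)
      ((2 * (nth 0%N ns i)%:R - (i.+1)%:R) ^+ (nth 0%N ks i))^-1.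

Definition Tbar_partial (ks : seq nat) (N : nat) : R :=
  \sum_(1 <= n < N.+1) (-1) ^+ n * Tbar_inner ks n.

(* Alternating multiple T-value (conditionally convergent series, summed as the
   limit of partial sums truncated on the largest index n_r); Tbar [::] = 1. *)
Definition Tbar (ks : seq nat) : R :=
  if ks is [::] then 1
  else 2 ^+ size ks * limn (Tbar_partial ks).

Definition W (k r : nat) : R :=
  \sum_(t : r.-tuple 'I_k.+1 | all (fun x => 0 < x)%N (map val t)
                                && (sumn (map val t) == k))
    Tbar (map val t).

Definition zetabar (s : nat) : R :=
  if s is 0%N then 2^-1
  else limn (fun N : nat => \sum_(1 <= n < N.+1) (-1) ^+ n.-1 / (n%:R ^+ s) : R).

Definition Z (j p : nat) : R :=
  if j == p then 1
  else \sum_(1 <= k < (p - j).+1)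
         (-2) ^+ k *
         \sum_(t : k.-tuple 'I_p.+1 | sorted ltn (j :: map val t)
                                      && (last j (map val t) == p))
           let s := j :: map val t in
           \prod_(l < k) zetabar (2 * nth 0%N s l.+1 - 2 * nth 0%N s l)%N.

End Defs.

(* Main.v *)
Require Import Defs.
From HB Require Import structures.
From mathcomp Require Import all_boot all_order all_algebra.
From mathcomp Require Import all_classical all_reals all_analysis.
From mathcomp Require Import complex ring lra zify.
Import Order.TTheory GRing.Theory Num.Theory.
Import numFieldNormedType.Exports.
Local Open Scope ring_scope.

Set Implicit Arguments.
Unset Strict Implicit.
Unset Printing Implicit Defensive.

(** Let A(x,y;t) be the sum of y^r 2^r t^(a_r) prod_i 1/(a_i - x) over chains
    a_1 < ... < a_r of alternating parity with a_1 odd; putting a_i = 2 n_i - i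
    one sees that at t = i the coefficients of A are the sums W(k,r) up to a
    power of i.  With U = log t and V = log((1+t)/(1-t)), it satisfies
    dA = (x dU + y dV) A - x dU.  The involution s = (1-t)/(1+t) exchanges U
    and -V, hence e^(-xU-yV) (A(x,y;t) + A(-y,-x;s) - 1) is constant.  On the
    circle |t+1|^2 = 2, which joins a real point to i, one has s = conj t, so
    the coefficients of this constant are real.

    At t = i this reads D = e^(i pi (x+y)) conj D for the symmetrized series D,
    and then S(x,y) = e^(i pi (x+y)) S(-x,-y) for S = D + conj D(-x,-y).  As S
    has no monomial odd in both variables, changing the sign of y and
    eliminating gives
      sin(pi x) (S(x,y) - S(x,-y)) = sin(pi y) (S(x,y) - S(-x,y)),
    which is the theorem once Z(j,p) is known to be the coefficient of
    x^(2(p-j)) in sin(pi x)/(pi x).  The latter follows from the duplication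
    f(x) cos(pi x/2) = f(x/2) for f(x) = sum_k zetabar(2k) x^(2k), obtained by
    evaluating at t = pi/2 the Fourier series sum_n (-1)^(n-1) cos(nt)/n^(2k),
    whose sum is a polynomial in t on [0, pi/2].

    Only truncated sums are handled along the circle: the truncated constant has
    derivative O(sqrt N |t|^(2N)), which integrates to o(1). *)

(** * Enumerating chains and compositions *)

Lemma sum_tuple_enum (V : nmodType) (r n : nat) (P : pred (seq nat))
    (l : seq (seq nat)) (F : seq nat -> V) :
  uniq l ->
  (forall s, (s \in l) = [&& size s == r, all (fun x => (x < n)%N) s & P s]) ->
  \sum_(t : r.-tuple 'I_n | P (map val t)) F (map val t) = \sum_(s <- l) F s.
Proof.
move=> l_uniq mem_l.
rewrite -(big_map (fun t : r.-tuple 'I_n => map val t) P F).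
rewrite -big_filter; apply: perm_big; apply: uniq_perm => //.
  rewrite filter_uniq // map_inj_uniq ?index_enum_uniq // => t1 t2 eq_t12.
  by apply: val_inj => /=; exact: (inj_map val_inj eq_t12).
move=> s; rewrite mem_filter mem_l; apply/andP/and3P.
  case=> Ps /mapP[t _ s_t]; split=> //.
    by rewrite s_t size_map size_tuple.
  by rewrite s_t all_map; apply/allP => i _ /=.
case=> size_s s_lt_n Ps; split=> //; apply/mapP.
have insubK_s : map val (pmap insub s : seq 'I_n) = s.
  elim: s s_lt_n {Ps size_s} => //= x s IH /andP[x_lt_n /IH {}IH].
  by rewrite insubT /= IH.
have size_t : size (pmap insub s : seq 'I_n) == r.
  by rewrite -(eqP size_s) -[in X in _ == X]insubK_s size_map.
by exists (Tuple size_t); rewrite ?mem_index_enum //= insubK_s.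
Qed.

Lemma uniq_allpairs_rcons (J : seq nat) (g : nat -> nat)
    (L : nat -> seq (seq nat)) :
  uniq J -> injective g -> (forall j, uniq (L j)) ->
  uniq [seq rcons s (g j) | j <- J, s <- L j].
Proof.
move=> J_uniq g_inj L_uniq.
apply: allpairs_uniq_dep => // -[j s] [j' s'] _ _ /= /eqP.
by rewrite eqseq_rcons => /andP[/eqP-> /eqP/g_inj->].
Qed.

Lemma uniq_allpairs_cons (J : seq nat) (L : nat -> seq (seq nat)) :
  uniq J -> (forall j, uniq (L j)) -> uniq [seq j :: s | j <- J, s <- L j].
Proof.
move=> J_uniq L_uniq.
by apply: allpairs_uniq_dep => // -[j s] [j' s'] _ _ /= [-> ->].
Qed.

Fixpoint chains_below (b n : nat) : seq (seq nat) :=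
  if b is b'.+1 then
    [seq rcons s m | m <- iota 1 n.-1, s <- chains_below b' m]
  else [:: [::]].

Lemma chains_below_uniq b n : uniq (chains_below b n).
Proof.
elim: b n => //= b IH n.
by apply: (@uniq_allpairs_rcons _ id) => //; exact: iota_uniq.
Qed.

Lemma mem_chains_below b n s : (s \in chains_below b n) =
  [&& size s == b, all (fun x => (x < n)%N) s & sorted ltn (0%N :: s)].
Proof.
elim: b n s => [|b IH] n s /=; first by rewrite inE; case: s.
apply/allpairsPdep/and3P => [[m [s' [m_range]]]|].
  rewrite IH => /and3P[/eqP size_s' s'_lt path_s'] ->.
  rewrite mem_iota in m_range; split; first by rewrite size_rcons size_s'.
    rewrite all_rcons; apply/andP; split; first by lia.
    by apply: sub_all s'_lt => x; lia.
  move: path_s'; rewrite /= rcons_path => -> /=.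
  case/lastP: s' s'_lt {size_s'} => [|s' x] /=; first by lia.
  by rewrite last_rcons all_rcons => /andP[].
case/lastP: s => [[]//|s m]; rewrite size_rcons eqSS all_rcons rcons_path.
move=> [size_s /andP[m_lt s_lt] /andP[path_s last_lt]]; exists m, s; split=> //.
  by rewrite mem_iota; lia.
rewrite IH size_s /= path_s andbT.
have : sorted ltn (rcons (0%N :: s) m) by rewrite /= rcons_path path_s.
by rewrite (sorted_pairwise ltn_trans) pairwise_rcons => /andP[/= /andP[]].
Qed.

Fixpoint compositions (a r : nat) : seq (seq nat) :=
  if r is r'.+1 then
    [seq rcons s j.+1 | j <- iota 0 a.+1, s <- compositions (a - j) r']
  else if a is 0%N then [:: [::]] else [::].

Lemma compositions_uniq a r : uniq (compositions a r).
Proof.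
elim: r a => [[]//|r IH a] /=.
apply: (@uniq_allpairs_rcons (0%N :: iota 1 a) S) => //.
- exact: (iota_uniq 0 a.+1).
- exact: succn_inj.
Qed.

Lemma size_le_sumn s : all (fun x => 0 < x)%N s -> (size s <= sumn s)%N.
Proof. by elim: s => //= x s IH /andP[x_gt0 /IH]; lia. Qed.

Lemma mem_leq_sumn x s : x \in s -> (x <= sumn s)%N.
Proof.
by elim: s => //= y s IH; rewrite inE => /orP[/eqP->|/IH]; lia.
Qed.

Lemma mem_compositions a r s : (s \in compositions a r) =
  [&& size s == r, all (fun x => (x < (a + r).+1)%N) s &
      all (fun x => 0 < x)%N s && (sumn s == (a + r)%N)].
Proof.
elim: r a s => [[|a] s|r IH a s]; [|by case: s|].
  by rewrite /= inE; case: s.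
apply/allpairsPdep/and3P => [[j [s' [j_range]]]|].
  rewrite IH => /and3P[/eqP size_s' s'_lt /andP[s'_gt0 /eqP sum_s']] ->.
  rewrite mem_iota in j_range; split; first by rewrite size_rcons size_s'.
    rewrite all_rcons; apply/andP; split; first by lia.
    by apply: sub_all s'_lt => x; lia.
  by rewrite all_rcons s'_gt0 -cats1 sumn_cat sum_s' /=; apply/eqP; lia.
case/lastP: s => [[]//|s m].
rewrite size_rcons eqSS !all_rcons -cats1 sumn_cat /=.
move=> [/eqP size_s _ /andP[/andP[m_gt0 s_gt0] /eqP sum_s]].
have r_le := size_le_sumn s_gt0; rewrite size_s in r_le.
exists m.-1, s; split => //.
- by rewrite (mem_iota 0 a.+1); lia.
- rewrite IH size_s eqxx s_gt0 /=; apply/andP; split; last by apply/eqP; lia.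
  by apply/allP => x /mem_leq_sumn; lia.
- by rewrite cats1 prednK.
Qed.

Lemma size_compositions a b s : s \in compositions a b -> size s = b.
Proof. by rewrite mem_compositions => /and3P[/eqP]. Qed.

Lemma compositions_gt0 a b s :
  s \in compositions a b -> all (fun x => 0 < x)%N s.
Proof. by rewrite mem_compositions => /and3P[_ _ /andP[]]. Qed.

(** * Nested sums *)

Section NestedSum.
Variable R : realType.

(* The exponents are listed from the largest index n_r down, and the sum is
   indexed by m = n_r - r, so that the denominator 2 n_r - r becomes 2 m + r and
   the chain condition n_(r-1) < n_r becomes a weak inequality. *)
Fixpoint nested_sum (ks : seq nat) (m : nat) : R :=
  if ks is k :: ks' then
    ((2 * m + size ks)%:R ^+ k)^-1 * \sum_(i < m.+1) nested_sum ks' i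
  else (m == 0%N)%:R.

Lemma natr_denom (n r : nat) : (r <= n)%N ->
  2 * n%:R - r%:R = (2 * (n - r) + r)%:R :> R.
Proof. by move=> r_le; rewrite -natrM -natrB; [congr _%:R|]; lia. Qed.

Lemma Tbar_inner_chains ks k n : Tbar_inner R (rcons ks k) n =
  ((2 * n%:R - (size ks).+1%:R) ^+ k)^-1 *
  \sum_(s <- chains_below (size ks) n) \prod_(i < size ks)
    ((2 * (nth 0%N s i)%:R - i.+1%:R) ^+ nth 0%N ks i)^-1.
Proof.
rewrite /Tbar_inner.
rewrite (@sum_tuple_enum _ _ _ (fun s => sorted ltn (0%N :: s))
  (chains_below (size (rcons ks k)).-1 n)
  (fun s => \prod_(i < size (rcons ks k))
     ((2 * (nth 0%N (rcons s n) i)%:R - i.+1%:R)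
        ^+ nth 0%N (rcons ks k) i)^-1)
  (chains_below_uniq _ _)); last by move=> s; rewrite mem_chains_below.
rewrite size_rcons mulr_sumr; apply: eq_big_seq => s.
rewrite mem_chains_below => /and3P[/eqP size_s _ _].
rewrite big_ord_recr /= mulrC !nth_rcons size_s ltnn eqxx; congr (_ * _).
by apply: eq_bigr => i _; rewrite !nth_rcons size_s ltn_ord.
Qed.

Lemma Tbar_inner1 k n : Tbar_inner R [:: k] n = ((2 * n%:R - 1) ^+ k)^-1.
Proof.
rewrite -[[:: k]]/(rcons [::] k) Tbar_inner_chains /=.
by rewrite big_seq1 big_ord0 mulr1.
Qed.

Lemma Tbar_inner_rcons ks k' k n : Tbar_inner R (rcons (rcons ks k') k) n =
  ((2 * n%:R - (size ks).+2%:R) ^+ k)^-1 *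
  \sum_(1 <= m < n) Tbar_inner R (rcons ks k') m.
Proof.
rewrite Tbar_inner_chains size_rcons /= big_allpairs_dep /=; congr (_ * _).
rewrite /index_iota subn1; apply: eq_bigr => m _.
rewrite Tbar_inner_chains mulr_sumr; apply: eq_big_seq => s.
rewrite mem_chains_below => /and3P[/eqP size_s _ _].
rewrite big_ord_recr /= mulrC !nth_rcons size_s ltnn eqxx; congr (_ * _).
by apply: eq_bigr => i _; rewrite !nth_rcons size_s ltn_ord.
Qed.

Lemma Tbar_inner_nested_sum k ks n : (0 < n)%N ->
  Tbar_inner R (rcons ks k) n =
  if (n <= size ks)%N then 0 else nested_sum (k :: rev ks) (n - (size ks).+1).
Proof.
elim/last_ind: ks k n => [|ks k' IH] k n n_gt0.
  rewrite Tbar_inner1 leqNgt n_gt0 /= big_ord_recl big1 // addr0 mulr1.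
  by rewrite (natr_denom n_gt0).
rewrite Tbar_inner_rcons (eq_big_nat _ _
  (F2 := fun m => if (m <= size ks)%N then 0
    else nested_sum (k' :: rev ks) (m - (size ks).+1))); last first.
  by move=> m /andP[m_gt0 _]; rewrite IH.
rewrite size_rcons rev_rcons.
have [n_le|n_gt] := leqP n (size ks).+1.
  rewrite big_nat_cond big1 ?mulr0 // => m /andP[/andP[_ m_lt] _].
  by rewrite ifT //; lia.
rewrite (@big_cat_nat _ _ _ (size ks).+1) //=; last by lia.
rewrite big_nat_cond big1 ?add0r => [|m /andP[/andP[_ m_lt] _]]; last first.
  by rewrite ifT //; lia.
rewrite natr_denom // -[X in \sum_(X <= _ < _) _]add0n big_addn.
rewrite -subSn // subSS big_mkord.
by rewrite /= size_rev; congr (_ * _); apply: eq_bigr => i _;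
   rewrite ifF ?addnK //; lia.
Qed.

Lemma Tbar_partial_nested_sum k ks N :
  Tbar_partial R (rcons ks k) (N + (size ks).+1) =
  (-1) ^+ (size ks).+1 *
  \sum_(m < N.+1) (-1) ^+ m * nested_sum (k :: rev ks) m.
Proof.
rewrite /Tbar_partial (@big_cat_nat _ _ _ (size ks).+1) //=; last by lia.
rewrite big_nat_cond big1 ?add0r => [|n /andP[/andP[n_gt0 n_lt] _]]; last first.
  by rewrite Tbar_inner_nested_sum // ifT ?mulr0.
rewrite -addSn -[X in \sum_(X <= _ < _) _]add0n big_addn addnK big_mkord.
rewrite mulr_sumr.
apply: eq_bigr => m _; rewrite Tbar_inner_nested_sum; last by lia.
rewrite ifF; last by lia.
by rewrite addnK exprD -mulrA mulrCA.
Qed.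

Lemma nested_sum_ge0 ks m : 0 <= nested_sum ks m.
Proof.
elim: ks m => [m|k ks IH m] /=; first exact: ler0n.
by rewrite mulr_ge0 ?sumr_ge0 // invr_ge0 exprn_ge0.
Qed.

Lemma inv_sqrt_le_telescope (n : nat) :
  (Num.sqrt n.+1%:R)^-1 <= 2 * (Num.sqrt n.+1%:R - Num.sqrt n%:R) :> R.
Proof.
have x_gt0 : 0 < Num.sqrt n.+1%:R :> R by rewrite sqrtr_gt0 ltr0n.
have sqr_x : Num.sqrt n.+1%:R ^+ 2 = n.+1%:R :> R by rewrite sqr_sqrtr // ler0n.
have sqr_y : Num.sqrt n%:R ^+ 2 = n%:R :> R by rewrite sqr_sqrtr // ler0n.
rewrite -[leLHS]mul1r ler_pdivrMr //.
move: sqr_x sqr_y; rewrite -natr1.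
by set x := Num.sqrt _; set y := Num.sqrt _; have := sqr_ge0 (x - y); nra.
Qed.

Lemma sum_inv_sqrt_le n :
  \sum_(i < n) (Num.sqrt i.+1%:R)^-1 <= 2 * Num.sqrt n%:R :> R.
Proof.
elim: n => [|n IH]; first by rewrite big_ord0 sqrtr0 mulr0.
by rewrite big_ord_recr /=; have := inv_sqrt_le_telescope n; lra.
Qed.

Lemma sum_inv_sqrt_cube_le n :
  \sum_(i < n) (i.+2%:R * Num.sqrt i.+2%:R)^-1 <= 2 :> R.
Proof.
suff : \sum_(i < n) (i.+2%:R * Num.sqrt i.+2%:R)^-1 <=
    2 - 2 / Num.sqrt n.+1%:R :> R.
  by move/le_trans; apply; rewrite gerBl divr_ge0.
elim: n => [|n IH]; first by rewrite big_ord0 sqrtr1 divr1 subrr.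
rewrite big_ord_recr /=; apply: le_trans (lerD IH (lexx _)) _.
have := inv_sqrt_le_telescope n.+1.
have x_gt0 : 0 < Num.sqrt n.+1%:R :> R by rewrite sqrtr_gt0 ltr0n.
have y_gt0 : 0 < Num.sqrt n.+2%:R :> R by rewrite sqrtr_gt0 ltr0n.
have x_le_y : Num.sqrt n.+1%:R <= Num.sqrt n.+2%:R :> R.
  by rewrite ler_sqrt ?ler_nat ?ler0n.
have sqr_y : n.+2%:R = Num.sqrt n.+2%:R ^+ 2 :> R by rewrite sqr_sqrtr // ler0n.
rewrite [X in (X * _)^-1]sqr_y.
move: x_gt0 y_gt0 x_le_y; set x := Num.sqrt _; set y := Num.sqrt n.+2%:R.
move=> x_gt0 y_gt0 x_le_y y_telescope.
suff : (y ^+ 2 * y)^-1 <= 2 * (x^-1 - y^-1) by lra.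
have -> : 2 * (x^-1 - y^-1) = (x * y)^-1 * (2 * (y - x)).
  by field; rewrite !gt_eqF.
apply: (@le_trans _ _ ((x * y)^-1 * y^-1)); last first.
  by rewrite ler_wpM2l // invr_ge0 mulr_ge0 // ltW.
rewrite -invfM lef_pV2 ?posrE ?mulr_gt0 ?exprn_gt0 //.
by rewrite ler_pM2r // expr2 ler_pM2r.
Qed.

Lemma inv_denom_le (k m r : nat) : (0 < k)%N ->
  ((2 * m + r.+1)%:R ^+ k)^-1 <= m.+1%:R^-1 :> R.
Proof.
case: k => // k _; rewrite lef_pV2 ?posrE ?exprn_gt0 ?ltr0n ?addnS //.
apply: (@le_trans _ _ (2 * m + r).+1%:R); first by rewrite ler_nat; lia.
by rewrite exprS ler_peMr ?ler0n // exprn_ege1 // ler1n.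
Qed.

Lemma nested_sum_le ks : all (fun k => 0 < k)%N ks ->
  exists2 C : R, 0 <= C &
    forall m, nested_sum ks m <= C / Num.sqrt m.+1%:R.
Proof.
elim: ks => [_|k ks IH /= /andP[k_gt0 /IH[C C_ge0 nested_le]]].
  exists 1 => // -[|m]; first by rewrite sqrtr1 divr1.
  by rewrite /= divr_ge0 ?sqrtr_ge0.
exists (C * 2) => [|m]; first by rewrite mulr_ge0.
have sqrt_gt0 : 0 < Num.sqrt m.+1%:R :> R by rewrite sqrtr_gt0 ltr0n.
have -> : C * 2 / Num.sqrt m.+1%:R =
    m.+1%:R^-1 * (C * (2 * Num.sqrt m.+1%:R)).
  rewrite -[in m.+1%:R^-1](@sqr_sqrtr _ m.+1%:R) ?ler0n //.
  by field; rewrite gt_eqF.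
apply: ler_pM.
- by rewrite invr_ge0 exprn_ge0.
- by apply: sumr_ge0 => i _; exact: nested_sum_ge0.
- exact: inv_denom_le.
apply: le_trans (ler_sum _ (fun i _ => nested_le (nat_of_ord i))) _.
by rewrite -mulr_sumr ler_wpM2l // sum_inv_sqrt_le.
Qed.

Lemma sum_nested_sum_le ks : all (fun k => 0 < k)%N ks ->
  exists2 C : R, 0 <= C &
    forall n, \sum_(m < n) nested_sum ks m <= C * Num.sqrt n%:R.
Proof.
move=> /nested_sum_le[C C_ge0 nested_le].
exists (C * 2) => [|n]; first by rewrite mulr_ge0.
apply: le_trans (ler_sum _ (fun m _ => nested_le (nat_of_ord m))) _.
by rewrite -mulr_sumr -mulrA ler_wpM2l // sum_inv_sqrt_le.
Qed.

End NestedSum.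

(** * Convergence of the alternating sums *)

Section AlternatingSums.
Variable R : realType.
Local Open Scope classical_set_scope.

Lemma cvg_inv_sqrt : (Num.sqrt n.+1%:R)^-1 @[n --> \oo] --> (0 : R).
Proof.
have sqrt_cvg : Num.sqrt \o harmonic @ \oo --> Num.sqrt (0 : R).
  by apply: continuous_cvg; [exact: sqrt_continuous|exact: cvg_harmonic].
rewrite sqrtr0 in sqrt_cvg.
rewrite (_ : (fun n => _) = Num.sqrt \o harmonic) //.
by apply: funext => n; rewrite /= sqrtrV // ler0n.
Qed.

Lemma alternating_cvg_bounded_variation (u : nat -> R) (M : R) :
  (forall N, \sum_(n < N) `|u n.+1 - u n| <= M) ->
  u n @[n --> \oo] --> 0 -> cvgn (fun N => \sum_(n < N) (-1) ^+ n * u n).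
Proof.
move=> u_bv u_cvg0.
pose d n := (-1) ^+ n * (u n - u n.+1).
have d_cvg : cvgn (series d).
  apply: normed_cvg; apply: nondecreasing_is_cvgn.
    by apply: nondecreasing_series => n _ _; exact: normr_ge0.
  exists M => _ [N _ <-]; apply: le_trans (u_bv N).
  rewrite /normed_series_of /series /= big_mkord.
  apply: ler_sum => n _.
  by rewrite /d normrM normrX normrN1 expr1n mul1r distrC.
have sumE N : \sum_(n < N) (-1) ^+ n * u n =
    2^-1 * (series d N + u 0%N - (-1) ^+ N * u N).
  rewrite /series /= big_mkord; elim: N => [|N IH].
    by rewrite !big_ord0 expr0; ring.
  by rewrite !big_ord_recr /= IH /d exprS; field.
have last_cvg0 : (-1) ^+ N * u N @[N --> \oo] --> 0.
  apply: norm_cvg0; under eq_fun do rewrite normrM normrX normrN1 expr1n mul1r.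
  by rewrite -(normr0 R); exact: cvg_norm.
rewrite (funext sumE); apply: is_cvgMl_tmp; apply: is_cvgB; last first.
  by apply/cvg_ex; exists 0.
by apply: is_cvgD => //; exact: is_cvg_cst.
Qed.

Lemma alternating_cvg_mul (v s : nat -> R) (M : R) :
  (forall n, 0 <= v n.+1 <= v n) -> (forall n, 0 <= s n <= s n.+1) ->
  (forall N, \sum_(n < N) v n.+1 * (s n.+1 - s n) <= M) ->
  v n * s n @[n --> \oo] --> 0 ->
  cvgn (fun N => \sum_(n < N) (-1) ^+ n * (v n * s n)).
Proof.
move=> v_decr s_incr sum_le vs_cvg0.
have v_ge0 n : 0 <= v n by have /andP[/le_trans] := v_decr n; apply.
have s_ge0 n : 0 <= s n by have /andP[] := s_incr n.
apply: (@alternating_cvg_bounded_variation (fun n => v n * s n)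
  (2 * M + v 0%N * s 0%N)) => // N.
suff variation_le : \sum_(n < N) `|v n.+1 * s n.+1 - v n * s n| <=
    2 * (\sum_(n < N) v n.+1 * (s n.+1 - s n)) + v 0%N * s 0%N - v N * s N.
  by have := mulr_ge0 (v_ge0 N) (s_ge0 N); have := sum_le N; lra.
elim: N => [|N IH]; first by rewrite !big_ord0; lra.
rewrite !big_ord_recr /=.
have /andP[v1 v2] := v_decr N; have /andP[s1 s2] := s_incr N.
suff : `|v N.+1 * s N.+1 - v N * s N| <=
    2 * (v N.+1 * (s N.+1 - s N)) + (v N * s N - v N.+1 * s N.+1) by lra.
have : 0 <= v N.+1 * (s N.+1 - s N) by rewrite mulr_ge0 // subr_ge0.
have : 0 <= (v N - v N.+1) * s N by rewrite mulr_ge0 // subr_ge0.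
by rewrite ler_norml => ? ?; apply/andP; split; lra.
Qed.

Lemma nested_sum_cvg0 ks : all (fun k => 0 < k)%N ks ->
  nested_sum R ks m @[m --> \oo] --> 0.
Proof.
move=> /(nested_sum_le R)[C C_ge0 nested_le].
apply: (@squeeze_cvgr _ _ _ _ (fun=> 0) (fun m => C * (Num.sqrt m.+1%:R)^-1)).
- by near=> m; rewrite nested_sum_ge0 nested_le.
- exact: cvg_cst.
- by rewrite -[X in _ --> X](mulr0 C); apply: cvgMl_tmp; exact: cvg_inv_sqrt.
Unshelve. all: by end_near. Qed.

Lemma nested_sum_alternating_cvg k ks : all (fun x => 0 < x)%N (k :: ks) ->
  cvgn (fun N => \sum_(m < N) (-1) ^+ m * nested_sum R (k :: ks) m).
Proof.
move=> kks_gt0; have /andP[k_gt0 ks_gt0] := kks_gt0.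
have [C C_ge0 nested_le] := nested_sum_le R ks_gt0.
apply: (@alternating_cvg_mul (fun m => ((2 * m + (size ks).+1)%:R ^+ k)^-1)
  (fun m => \sum_(i < m.+1) nested_sum R ks i) (C * 2)).
- move=> n; rewrite invr_ge0 exprn_ge0 //=.
  rewrite lef_pV2 ?posrE ?exprn_gt0 ?ltr0n ?addnS //.
  by rewrite lerXn2r ?nnegrE // ler_nat; lia.
- move=> n; rewrite sumr_ge0 /= => [|i _]; last exact: nested_sum_ge0.
  by rewrite [leRHS]big_ord_recr /= lerDl nested_sum_ge0.
- move=> N; apply: (@le_trans _ _
      (\sum_(n < N) C * (n.+2%:R * Num.sqrt n.+2%:R)^-1)); last first.
    by rewrite -mulr_sumr ler_wpM2l // sum_inv_sqrt_cube_le.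
  apply: ler_sum => n _; rewrite [X in _ * (X - _)]big_ord_recr /=.
  rewrite addrAC subrr add0r invfM mulrCA.
  apply: ler_pM; rewrite ?invr_ge0 ?exprn_ge0 //.
    exact: nested_sum_ge0.
  exact: inv_denom_le.
- exact: (nested_sum_cvg0 kks_gt0).
Qed.

Lemma Tbar_cvg s : all (fun x => 0 < x)%N s ->
  (-2) ^+ size s * \sum_(m < N.+1) (-1) ^+ m * nested_sum R (rev s) m
    @[N --> \oo] --> Tbar R s.
Proof.
case/lastP: s => [_|s k].
  rewrite (_ : (fun N => _) = fun=> 1); first exact: cvg_cst.
  apply: funext => N; rewrite mul1r big_ord_recl big1 => [|m _].
    by rewrite addr0 mul1r.
  exact: mulr0.
rewrite -all_rev rev_rcons => /nested_sum_alternating_cvg.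
case/cvg_ex => l; rewrite -cvg_shiftS => sum_cvg.
have partial_cvg : Tbar_partial R (rcons s k) N @[N --> \oo] -->
    (-1) ^+ (size s).+1 * l.
  rewrite -(cvg_shiftn (size s).+1).
  rewrite (_ : [sequence _]_N = fun N => (-1) ^+ (size s).+1 *
      \sum_(m < N.+1) (-1) ^+ m * nested_sum R (k :: rev s) m).
    exact: cvgMl_tmp.
  by apply: funext => N; exact: Tbar_partial_nested_sum.
have -> : Tbar R (rcons s k) =
    2 ^+ size (rcons s k) * limn (Tbar_partial R (rcons s k)) by case: (s).
rewrite (cvg_lim _ partial_cvg) // size_rcons mulrA -exprMn mulrN1.
exact: cvgMl_tmp.
Qed.

End AlternatingSums.

(** * Sums of nested sums of fixed weight and depth *)

Section WeightSum.
Variable R : realType.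
Local Open Scope classical_set_scope.

(* [a] is the weight minus the depth [b]. *)
Definition weight_sum (a b m : nat) : R :=
  \sum_(s <- compositions a b) nested_sum R (rev s) m.

Lemma weight_sum0 a m : weight_sum a 0 m = ((a == 0%N) && (m == 0%N))%:R.
Proof. by rewrite /weight_sum; case: a => [|a]; rewrite ?big_seq1 ?big_nil. Qed.

Lemma weight_sumS a b m : weight_sum a b.+1 m =
  \sum_(j < a.+1) ((2 * m + b.+1)%:R ^+ j.+1)^-1 *
    \sum_(i < m.+1) weight_sum (a - j) b i.
Proof.
rewrite /weight_sum.
rewrite -(big_mkord xpredT (fun j => ((2 * m + b.+1)%:R ^+ j.+1)^-1 *
  \sum_(i < m.+1) \sum_(s <- compositions (a - j) b) nested_sum R (rev s) i)).
rewrite [LHS]big_allpairs_dep /index_iota subn0; apply: eq_bigr => j _.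
rewrite exchange_big mulr_sumr.
apply: eq_big_seq => s /size_compositions size_s.
by rewrite rev_rcons /= size_rev size_s.
Qed.

Lemma weight_sum_step a b m : (2 * m + b.+1)%:R * weight_sum a b.+1 m =
  (if a is a'.+1 then weight_sum a' b.+1 m else 0)
  + \sum_(i < m.+1) weight_sum a b i.
Proof.
have denom_neq0 : (2 * m + b.+1)%:R != 0 :> R by rewrite pnatr_eq0 addnS.
case: a => [|a]; first by rewrite weight_sumS big_ord1 expr1 mulVKf // add0r.
rewrite !weight_sumS big_ord_recl mulrDr addrC expr1 mulVKf //; congr (_ + _).
rewrite mulr_sumr; apply: eq_bigr => j _; rewrite subSS.
by rewrite lift0 exprS invfM mulrA mulrA mulfV // mul1r.
Qed.

Lemma sum_weight_sum_ge0 a b n : 0 <= \sum_(m < n) weight_sum a b m.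
Proof.
by do 2!apply: sumr_ge0 => ? _; exact: nested_sum_ge0.
Qed.

Lemma sum_weight_sum_le a b : exists2 C : R, 0 <= C &
  forall n, \sum_(m < n) weight_sum a b m <= C * Num.sqrt n%:R.
Proof.
rewrite /weight_sum; elim: (compositions a b) (@compositions_gt0 a b)
  => [_|s l IH l_gt0].
  by exists 0 => // n; rewrite big1 ?mul0r // => m _; rewrite big_nil.
have [t tl|C C_ge0 l_le] := IH; first by apply: l_gt0; rewrite inE tl orbT.
have s_gt0 : all (fun x => 0 < x)%N (rev s).
  by rewrite all_rev l_gt0 ?mem_head.
have [C' C'_ge0 s_le] := sum_nested_sum_le R s_gt0.
exists (C' + C) => [|n]; first by rewrite addr_ge0.
under eq_bigr do rewrite big_cons.
by rewrite big_split mulrDl; exact: lerD.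
Qed.

Definition W_partial (N a b : nat) : R :=
  (-2) ^+ b * \sum_(m < N.+1) (-1) ^+ m * weight_sum a b m.

Definition W_coef (a b : nat) : R := W R (a + b) b.

Lemma W_partial_cvg a b : W_partial N a b @[N --> \oo] --> W_coef a b.
Proof.
rewrite /W_coef /W (@sum_tuple_enum _ _ _
  (fun s => all (fun x => 0 < x)%N s && (sumn s == (a + b)%N))
  (compositions a b) (Tbar R) (compositions_uniq _ _)); last first.
  by move=> s; rewrite mem_compositions.
rewrite (_ : (fun N => _) = fun N => \sum_(s <- compositions a b)
  (-2) ^+ size s * \sum_(m < N.+1) (-1) ^+ m * nested_sum R (rev s) m).
  rewrite big_seq; under eq_cvg do rewrite big_seq.
  apply: cvg_big => [|s s_comp]; first exact: add_continuous.
  exact: Tbar_cvg (compositions_gt0 s_comp).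
apply: funext => N; rewrite /W_partial /weight_sum.
under eq_bigr do rewrite mulr_sumr.
rewrite exchange_big mulr_sumr.
by apply: eq_big_seq => s /size_compositions ->; rewrite mulr_sumr.
Qed.

End WeightSum.

(** * Formal power series *)

Section FormalPowerSeries.
Variable A : comNzRingType.

Definition fps : Type := nat -> A.
Implicit Types F G H : fps.

HB.instance Definition _ := GRing.Zmodule.copy fps (nat -> A).

Definition fps_const (c : A) : fps := fun n => if n is 0%N then c else 0.
Definition fps_mul F G : fps := fun n => \sum_(i < n.+1) F i * G (n - i)%N.

Let trunc (N : nat) F : {poly A} := \poly_(i < N) F i.

Let coef_trunc_mul N F G n : (n < N)%N ->
  (trunc N F * trunc N G)`_n = fps_mul F G n.
Proof.
move=> n_lt; rewrite coefM; apply: eq_bigr => i _; have := ltn_ord i => i_lt.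
by rewrite !coef_poly !ifT //; lia.
Qed.

Let coef_trunc_mul_congr N (p q : {poly A}) F n : (n < N)%N ->
  (forall m, (m < N)%N -> p`_m = q`_m) ->
  (trunc N F * p)`_n = (trunc N F * q)`_n.
Proof.
move=> n_lt eq_pq; rewrite !coefM; apply: eq_bigr => i _.
by rewrite eq_pq //; lia.
Qed.

Let fps_mulC : commutative fps_mul.
Proof.
by move=> F G; apply: funext => n; rewrite -!(@coef_trunc_mul n.+1) // mulrC.
Qed.

Let fps_mulA : associative fps_mul.
Proof.
move=> F G H; apply: funext => n; have n_lt := ltnSn n.
rewrite (fps_mulC (fps_mul F G)) -!(@coef_trunc_mul n.+1) //.
have trunc_mul K L m : (m < n.+1)%N ->
    (trunc n.+1 (fps_mul K L))`_m = (trunc n.+1 K * trunc n.+1 L)`_m.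
  by move=> m_lt; rewrite coef_poly m_lt coef_trunc_mul.
rewrite (coef_trunc_mul_congr _ n_lt (@trunc_mul _ _)).
rewrite [RHS](coef_trunc_mul_congr _ n_lt (@trunc_mul _ _)).
by rewrite mulrA (mulrC (trunc n.+1 H)).
Qed.

Lemma fps_const_mulE c F n : fps_mul (fps_const c) F n = c * F n.
Proof.
rewrite /fps_mul big_ord_recl subn0 big1 ?addr0 // => i _; exact: mul0r.
Qed.

Let fps_mul1 : left_id (fps_const 1) fps_mul.
Proof. by move=> F; apply: funext => n; rewrite fps_const_mulE mul1r. Qed.

Let fps_mulDl : left_distributive fps_mul +%R.
Proof.
move=> F G H; apply: funext => n.
rewrite [RHS](_ : _ = fps_mul F H n + fps_mul G H n) // -big_split.
by apply: eq_bigr => i _; exact: mulrDl.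
Qed.

Let fps_1neq0 : fps_const 1 != 0 :> fps.
Proof. by apply/eqP => /(congr1 (@^~ 0%N)) /eqP; rewrite oner_eq0. Qed.

HB.instance Definition _ := GRing.Zmodule_isComNzRing.Build fps
  fps_mulA fps_mulC fps_mul1 fps_mulDl fps_1neq0.

Lemma fpsDE F G n : (F + G : fps) n = F n + G n. Proof. by []. Qed.
Lemma fpsBE F G n : (F - G : fps) n = F n - G n. Proof. by []. Qed.
Lemma fpsME F G n : (F * G : fps) n = \sum_(i < n.+1) F i * G (n - i)%N.
Proof. by []. Qed.
Lemma fps1E n : (1 : fps) n = (n == 0%N)%:R. Proof. by case: n. Qed.
Lemma fps_constME c F n : (fps_const c * F : fps) n = c * F n.
Proof. exact: fps_const_mulE. Qed.

Lemma fps_sumE n (F : 'I_n -> fps) k :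
  (\sum_(i < n) F i) k = \sum_(i < n) F i k.
Proof. by elim/big_rec2: _ => // i x y _ <-. Qed.

Let fps_const_is_zmod_morphism : zmod_morphism fps_const.
Proof. by move=> c d; apply: funext => -[|n] //=; rewrite fpsBE subr0. Qed.

Let fps_const_is_monoid_morphism : monoid_morphism fps_const.
Proof.
split=> // c d; apply: funext => n; rewrite fps_constME.
by case: n => //= n; rewrite mulr0.
Qed.

HB.instance Definition _ :=
  GRing.isZmodMorphism.Build A fps fps_const fps_const_is_zmod_morphism.
HB.instance Definition _ :=
  GRing.isMonoidMorphism.Build A fps fps_const fps_const_is_monoid_morphism.

Definition fps_X : fps := fun n => (n == 1%N)%:R.

Lemma fps_XME F n : (fps_X * F : fps) n = if n is n'.+1 then F n' else 0.
Proof.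
rewrite fpsME; case: n => [|n]; first by rewrite big_ord1 mul0r.
rewrite !big_ord_recl big1 => [|i _]; last by rewrite /fps_X /= mul0r.
by rewrite /fps_X /= mul0r add0r mul1r addr0 subSS subn0.
Qed.

Definition fps_scale (c : A) F : fps := fun n => c ^+ n * F n.

Let fps_scale_is_zmod_morphism c : zmod_morphism (fps_scale c).
Proof. by move=> F G; apply: funext => n; rewrite /fps_scale fpsBE mulrBr. Qed.

Let fps_scale_is_monoid_morphism c : monoid_morphism (fps_scale c).
Proof.
split=> [|F G]; apply: funext => n; rewrite /fps_scale.
  by rewrite fps1E; case: n => [|n]; rewrite ?mulr0 ?mulr1.
rewrite !fpsME mulr_sumr; apply: eq_bigr => i _.
rewrite mulrACA -exprD subnKC // -ltnS; exact: ltn_ord.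
Qed.

HB.instance Definition _ c := GRing.isZmodMorphism.Build fps fps (fps_scale c)
  (fps_scale_is_zmod_morphism c).
HB.instance Definition _ c := GRing.isMonoidMorphism.Build fps fps (fps_scale c)
  (fps_scale_is_monoid_morphism c).

End FormalPowerSeries.

Section FpsMap.
Variables (A B : comNzRingType) (f : {rmorphism A -> B}).

Definition fps_map (F : fps A) : fps B := fun n => f (F n).

Let fps_map_is_zmod_morphism : zmod_morphism fps_map.
Proof. by move=> F G; apply: funext => n; exact: rmorphB. Qed.

Let fps_map_is_monoid_morphism : monoid_morphism fps_map.
Proof.
split=> [|F G]; apply: funext => n; rewrite /fps_map.
  by rewrite !fps1E rmorph_nat.
by rewrite !fpsME rmorph_sum; apply: eq_bigr => i _; exact: rmorphM.
Qed.

HB.instance Definition _ := GRing.isZmodMorphism.Build (fps A) (fps B) fps_map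
  fps_map_is_zmod_morphism.
HB.instance Definition _ := GRing.isMonoidMorphism.Build (fps A) (fps B) fps_map
  fps_map_is_monoid_morphism.

End FpsMap.

Section FpsExp.
Variable K : numFieldType.

Definition fps_exp (c : K) : fps K := fun n => c ^+ n / n`!%:R.

Lemma natr_fact_neq0 n : n`!%:R != 0 :> K.
Proof. by rewrite pnatr_eq0 -lt0n fact_gt0. Qed.

Lemma fps_expD c d : fps_exp (c + d) = fps_exp c * fps_exp d.
Proof.
apply: funext => n; rewrite fpsME /fps_exp addrC exprDn mulr_suml.
apply: eq_bigr => i _; have i_le : (i <= n)%N by rewrite -ltnS ltn_ord.
rewrite -(bin_fact i_le) !natrM -mulr_natr.
have bin_neq0 : 'C(n, i)%:R != 0 :> K by rewrite pnatr_eq0 -lt0n bin_gt0.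
by field; rewrite !natr_fact_neq0 bin_neq0.
Qed.

Lemma fps_exp0 : fps_exp 0 = 1.
Proof.
apply: funext => -[|n]; first by rewrite /fps_exp expr0 fact0 divr1.
by rewrite /fps_exp expr0n mul0r.
Qed.

Lemma fps_expN c : fps_exp c * fps_exp (- c) = 1.
Proof. by rewrite -fps_expD subrr fps_exp0. Qed.

Lemma fps_scale_exp a c : fps_scale a (fps_exp c) = fps_exp (a * c).
Proof.
by apply: funext => n; rewrite /fps_scale /fps_exp exprMn mulrA.
Qed.

(* The expansions of 2 sinh (c x) and 2 cosh (c x). *)
Definition fps_sinh2 c : fps K := fps_exp c - fps_exp (- c).
Definition fps_cosh2 c : fps K := fps_exp c + fps_exp (- c).

Lemma fps_sinh2E c n : fps_sinh2 c n = if odd n then 2 * fps_exp c n else 0.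
Proof.
rewrite /fps_sinh2 fpsBE /fps_exp exprNn -signr_odd; case: (odd n).
  by rewrite expr1; ring.
by rewrite expr0 mul1r subrr.
Qed.

Lemma fps_cosh2E c n : fps_cosh2 c n = if odd n then 0 else 2 * fps_exp c n.
Proof.
rewrite /fps_cosh2 fpsDE /fps_exp exprNn -signr_odd; case: (odd n).
  by rewrite expr1; ring.
by rewrite expr0; ring.
Qed.

Lemma fps_sinh2_double c : fps_sinh2 (c + c) = fps_sinh2 c * fps_cosh2 c.
Proof. by rewrite /fps_sinh2 opprD !fps_expD -!expr2 subr_sqr. Qed.

Lemma fps_scale_sinh2 a c : fps_scale a (fps_sinh2 c) = fps_sinh2 (a * c).
Proof. by rewrite rmorphB /= !fps_scale_exp mulrN. Qed.

End FpsExp.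

(** * Bivariate power series *)

Notation fps2 A := (fps (fps A)).

Section BivariateSeries.
Variable A : comNzRingType.
Implicit Types (F G : fps2 A) (u : fps A) (c d : A).

(* The outer index is the exponent of X and the inner one that of Y. *)
Definition fps2_X : fps2 A := fps_X (fps A).
Definition fps2_Y : fps2 A := fps_const (fps_X A).
Definition fps2_const c : fps2 A := fps_const (fps_const c).
Definition in_X u : fps2 A := fps_map (@fps_const A) u.
Definition in_Y u : fps2 A := fps_const u.

HB.instance Definition _ := GRing.RMorphism.copy fps2_const
  (@fps_const (fps A) \o @fps_const A).
HB.instance Definition _ := GRing.RMorphism.copy in_X (fps_map (@fps_const A)).
HB.instance Definition _ := GRing.RMorphism.copy in_Y (@fps_const (fps A)).

Lemma fps2P F G : (forall a b, F a b = G a b) -> F = G.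
Proof. by move=> eqFG; apply: funext => a; apply: funext => b. Qed.

Lemma fps2DE F G a b : (F + G : fps2 A) a b = F a b + G a b. Proof. by []. Qed.
Lemma fps2NE F a b : (- F : fps2 A) a b = - F a b. Proof. by []. Qed.
Lemma fps2BE F G a b : (F - G : fps2 A) a b = F a b - G a b. Proof. by []. Qed.
Lemma fps2_1E a b : (1 : fps2 A) a b = ((a == 0%N) && (b == 0%N))%:R.
Proof. by case: a b => [|a] [|b]. Qed.

Lemma fps2_XE a b : fps2_X a b = ((a == 1%N) && (b == 0%N))%:R.
Proof. by case: a b => [|[|a]] [|b]. Qed.

Lemma fps2_YE a b : fps2_Y a b = ((a == 0%N) && (b == 1%N))%:R.
Proof. by case: a b => [|a] [|b]. Qed.

Lemma fps2_constE c a b :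
  fps2_const c a b = if (a == 0%N) && (b == 0%N) then c else 0.
Proof. by case: a b => [|a] [|b]. Qed.

Lemma fps2ME F G a b : (F * G : fps2 A) a b =
  \sum_(i < a.+1) \sum_(j < b.+1) F i j * G (a - i)%N (b - j)%N.
Proof. by rewrite fpsME fps_sumE. Qed.

Lemma fps2_constME c F a b : (fps2_const c * F : fps2 A) a b = c * F a b.
Proof. by rewrite !fps_constME. Qed.

Lemma fps2_XME F a b :
  (fps2_X * F : fps2 A) a b = if a is a'.+1 then F a' b else 0.
Proof. by rewrite fps_XME; case: a. Qed.

Lemma fps2_YME F a b :
  (fps2_Y * F : fps2 A) a b = if b is b'.+1 then F a b' else 0.
Proof. by rewrite fps_constME fps_XME. Qed.

Lemma in_XE u a b : in_X u a b = if b is 0%N then u a else 0.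
Proof. by []. Qed.

Lemma in_YE u a b : in_Y u a b = if a is 0%N then u b else 0.
Proof. by case: a. Qed.

Lemma in_XME u F a b :
  (in_X u * F : fps2 A) a b = \sum_(i < a.+1) u i * F (a - i)%N b.
Proof.
by rewrite fpsME fps_sumE; apply: eq_bigr => i _; rewrite fps_constME.
Qed.

Lemma in_YME u F a b :
  (in_Y u * F : fps2 A) a b = \sum_(j < b.+1) u j * F a (b - j)%N.
Proof. by rewrite fps_constME fpsME. Qed.

Definition fps2_scale c d : fps2 A -> fps2 A :=
  fps_scale (fps_const c) \o fps_map (fps_scale d).

HB.instance Definition _ c d := GRing.RMorphism.copy (fps2_scale c d)
  (fps_scale (fps_const c) \o fps_map (fps_scale d)).

Lemma fps2_scaleE c d F a b : fps2_scale c d F a b = c ^+ a * d ^+ b * F a b.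
Proof.
by rewrite /fps2_scale /= /fps_scale -rmorphXn fps_constME /fps_map mulrA.
Qed.

Definition fps2_swap F : fps2 A := fun a b => F b a.

Let fps2_swap_is_zmod_morphism : zmod_morphism fps2_swap.
Proof. by []. Qed.

Let fps2_swap_is_monoid_morphism : monoid_morphism fps2_swap.
Proof.
split=> [|F G]; apply: fps2P => a b; first by case: a b => [|a] [|b].
by rewrite [LHS]fps2ME fps2ME exchange_big.
Qed.

HB.instance Definition _ := GRing.isZmodMorphism.Build (fps2 A) (fps2 A)
  fps2_swap fps2_swap_is_zmod_morphism.
HB.instance Definition _ := GRing.isMonoidMorphism.Build (fps2 A) (fps2 A)
  fps2_swap fps2_swap_is_monoid_morphism.

End BivariateSeries.

Lemma fps2_scaleM (A : comNzRingType) (c d c' d' : A) (F : fps2 A) :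
  fps2_scale c d (fps2_scale c' d' F) = fps2_scale (c * c') (d * d') F.
Proof.
by apply: fps2P => a b; rewrite !fps2_scaleE !exprMn mulrA; congr (_ * _); ring.
Qed.

Lemma fps2_scale_in_X (A : comNzRingType) (c d : A) (u : fps A) :
  fps2_scale c d (in_X u) = in_X (fps_scale c u).
Proof.
apply: fps2P => a b; rewrite fps2_scaleE !in_XE /fps_scale.
by case: b => [|b]; rewrite ?mulr0 ?mulr1.
Qed.

Lemma fps2_scale_in_Y (A : comNzRingType) (c d : A) (u : fps A) :
  fps2_scale c d (in_Y u) = in_Y (fps_scale d u).
Proof.
apply: fps2P => a b; rewrite fps2_scaleE !in_YE /fps_scale.
by case: a => [|a]; rewrite ?mulr0 ?mul1r.
Qed.

(** * Complex derivatives along a real variable *)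

Section ComplexDerivative.
Variable R : realType.
Implicit Types (f g : R -> R[i]) (x : R) (z d e : R[i]) (n : nat).

Local Notation Re := (@complex.Re R).
Local Notation Im := (@complex.Im R).

Lemma complexP z e : Re z = Re e -> Im z = Im e -> z = e.
Proof. by case: z => ? ?; case: e => ? ? /= -> ->. Qed.

Lemma complexReM z e : Re (z * e) = Re z * Re e - Im z * Im e.
Proof. by case: z; case: e. Qed.

Lemma complexImM z e : Im (z * e) = Re z * Im e + Im z * Re e.
Proof. by case: z; case: e. Qed.

Lemma complexReJ z : Re z^*%C = Re z. Proof. by case: z. Qed.
Lemma complexImJ z : Im z^*%C = - Im z. Proof. by case: z. Qed.

Definition is_cderive x f d :=
  is_derive x 1 (fun t => Re (f t)) (Re d) /\
  is_derive x 1 (fun t => Im (f t)) (Im d).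

Lemma is_cderive_eq x f d e : is_cderive x f d -> d = e -> is_cderive x f e.
Proof. by move=> f_der <-. Qed.

Lemma is_cderive_cst x z : is_cderive x (fun=> z) 0.
Proof. by split; exact: is_derive_cst. Qed.

Lemma is_cderiveD x f g d e : is_cderive x f d -> is_cderive x g e ->
  is_cderive x (fun t => f t + g t) (d + e).
Proof.
move=> [fr fi] [gr gi]; split; rewrite raddfD; under eq_fun do rewrite raddfD.
  exact: (is_deriveD fr gr).
exact: (is_deriveD fi gi).
Qed.

Lemma is_cderiveM x f g d e : is_cderive x f d -> is_cderive x g e ->
  is_cderive x (fun t => f t * g t) (d * g x + f x * e).
Proof.
move=> [fr fi] [gr gi]; split; rewrite raddfD.
  rewrite /= !complexReM; under eq_fun do rewrite complexReM.
  apply: is_derive_eq (is_deriveB (is_deriveM fr gr) (is_deriveM fi gi)) _.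
  by rewrite /GRing.scale /=; ring.
rewrite /= !complexImM; under eq_fun do rewrite complexImM.
apply: is_derive_eq (is_deriveD (is_deriveM fr gi) (is_deriveM fi gr)) _.
by rewrite /GRing.scale /=; ring.
Qed.

Lemma is_cderiveZ x f d z : is_cderive x f d ->
  is_cderive x (fun t => z * f t) (z * d).
Proof.
move=> f_der; apply: is_cderive_eq (is_cderiveM (is_cderive_cst x z) f_der) _.
by rewrite mul0r add0r.
Qed.

Lemma is_cderiveN x f d : is_cderive x f d ->
  is_cderive x (fun t => - f t) (- d).
Proof.
by move=> /(is_cderiveZ (-1)); under eq_fun do rewrite mulN1r; rewrite mulN1r.
Qed.

Lemma is_cderive_sum n x (f : 'I_n -> R -> R[i]) (d : 'I_n -> R[i]) :
  (forall i, is_cderive x (f i) (d i)) ->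
  is_cderive x (fun t => \sum_(i < n) f i t) (\sum_(i < n) d i).
Proof.
elim: n f d => [|n IH] f d f_der.
  by rewrite big_ord0; under eq_fun do rewrite big_ord0; exact: is_cderive_cst.
rewrite big_ord_recl; under eq_fun do rewrite big_ord_recl.
by apply: is_cderiveD => //; apply: IH.
Qed.

Lemma is_cderiveJ x f d : is_cderive x f d ->
  is_cderive x (fun t => (f t)^*%C) d^*%C.
Proof.
move=> [fr fi]; split.
  by rewrite complexReJ; under eq_fun do rewrite complexReJ.
by rewrite complexImJ; under eq_fun do rewrite complexImJ; exact: is_deriveN.
Qed.

Lemma is_cderiveX x f d n : is_cderive x f d ->
  is_cderive x (fun t => f t ^+ n.+1) (n.+1%:R * f x ^+ n * d).
Proof.
move=> f_der; elim: n => [|n IH]; first by rewrite expr0 !mul1r.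
under eq_fun do rewrite exprS.
apply: is_cderive_eq (is_cderiveM f_der IH) _.
by rewrite !exprS -(natr1 n.+1); ring.
Qed.

Definition is_fps2_derive x (F : R -> fps2 R[i]) (D : fps2 R[i]) :=
  forall a b, is_cderive x (fun t => F t a b) (D a b).

Implicit Types (F G : R -> fps2 R[i]) (D E : fps2 R[i]).

Lemma is_fps2_derive_eq x F D E :
  is_fps2_derive x F D -> D = E -> is_fps2_derive x F E.
Proof. by move=> F_der <-. Qed.

Lemma is_fps2_derive_cst x D : is_fps2_derive x (fun=> D) 0.
Proof. by move=> a b; exact: is_cderive_cst. Qed.

Lemma is_fps2_deriveD x F G D E :
  is_fps2_derive x F D -> is_fps2_derive x G E ->
  is_fps2_derive x (fun t => F t + G t) (D + E).
Proof. by move=> F_der G_der a b; exact: is_cderiveD. Qed.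

Lemma is_fps2_deriveM x F G D E :
  is_fps2_derive x F D -> is_fps2_derive x G E ->
  is_fps2_derive x (fun t => F t * G t) (D * G x + F x * E).
Proof.
move=> F_der G_der a b; rewrite fps2DE !fps2ME; under eq_fun do rewrite fps2ME.
rewrite -big_split; apply: is_cderive_sum => i; rewrite -big_split.
by apply: is_cderive_sum => j; exact: is_cderiveM.
Qed.

Lemma is_cderive_fps_exp x f d n : is_cderive x f d ->
  is_cderive x (fun t => fps_exp (f t) n)
    (d * (if n is n'.+1 then fps_exp (f x) n' else 0)).
Proof.
move=> f_der; case: n => [|n].
  rewrite mulr0; under eq_fun do rewrite /fps_exp expr0.
  exact: is_cderive_cst.
under eq_fun do rewrite /fps_exp mulrC.
apply: is_cderive_eq (is_cderiveZ _ (is_cderiveX n f_der)) _.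
have n1_neq0 : n.+1%:R != 0 :> R[i] by rewrite pnatr_eq0.
by rewrite /fps_exp factS natrM; field; rewrite natr_fact_neq0 nat1r n1_neq0.
Qed.

Lemma is_fps2_derive_exp_X x f d : is_cderive x f d ->
  is_fps2_derive x (fun t => in_X (fps_exp (f t)))
    (fps2_const d * fps2_X _ * in_X (fps_exp (f x))).
Proof.
move=> f_der a b; rewrite -mulrA fps2_constME fps2_XME.
under eq_fun do rewrite in_XE; case: b => [|b].
  apply: is_cderive_eq (is_cderive_fps_exp a f_der) _.
  by case: a => // a; rewrite in_XE.
by case: a => [|a]; rewrite ?in_XE mulr0; exact: is_cderive_cst.
Qed.

Lemma is_fps2_derive_exp_Y x f d : is_cderive x f d ->
  is_fps2_derive x (fun t => in_Y (fps_exp (f t)))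
    (fps2_const d * fps2_Y _ * in_Y (fps_exp (f x))).
Proof.
move=> f_der a b; rewrite -mulrA fps2_constME fps2_YME.
under eq_fun do rewrite in_YE; case: a => [|a].
  apply: is_cderive_eq (is_cderive_fps_exp b f_der) _.
  by case: b => // b; rewrite in_YE.
by case: b => [|b]; rewrite ?in_YE mulr0; exact: is_cderive_cst.
Qed.

End ComplexDerivative.

(** * The contour from the real axis to i *)

Section Contour.
Variable R : realType.
Implicit Types (w : R).

(* The circle |t + 1|^2 = 2 in polar coordinates t = rho e^(i w): rho is the
   positive root of rho^2 + 2 rho cos w = 1, and 1 / rho = disc + cos w. *)
Definition disc w : R := Num.sqrt (1 + cos w ^+ 2).
Definition rho w : R := disc w - cos w.
Definition dlog_rho w : R := sin w / disc w.

Lemma sqr_disc w : disc w ^+ 2 = 1 + cos w ^+ 2.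
Proof. by rewrite sqr_sqrtr // addr_ge0 // sqr_ge0. Qed.

Lemma disc_ge1 w : 1 <= disc w.
Proof.
by rewrite -[leLHS]sqrtr1 ler_sqrt ?lerDl ?sqr_ge0 // addr_ge0 // sqr_ge0.
Qed.

Lemma disc_gt0 w : 0 < disc w.
Proof. exact: lt_le_trans (disc_ge1 w). Qed.

Lemma disc_neq0 w : disc w != 0.
Proof. by rewrite gt_eqF ?disc_gt0. Qed.

Lemma rho_gt0 w : 0 < rho w.
Proof.
rewrite subr_gt0; apply: le_lt_trans (ler_norm _) _.
rewrite -(@ltr_pXn2r _ 2) ?nnegrE ?normr_ge0 ?sqrtr_ge0 //.
by rewrite sqr_disc real_normK ?num_real // ltrDr.
Qed.

Lemma rhoV w : (rho w)^-1 = disc w + cos w.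
Proof.
have rho_neq0 : rho w != 0 by rewrite gt_eqF ?rho_gt0.
by apply: (mulfI rho_neq0); rewrite mulfV // -subr_sqr sqr_disc addrK.
Qed.

Lemma is_derive_disc w : is_derive w 1 disc (- cos w * sin w / disc w).
Proof.
have radicand_gt0 : 0 < 1 + cos w ^+ 2 by rewrite ltr_pwDl // sqr_ge0.
have radicand_der :
    is_derive w 1 (fun u => 1 + cos u ^+ 2 : R) (- 2 * cos w * sin w).
  apply: is_derive_eq (is_deriveD (is_derive_cst _ _ _)
    (is_deriveX 2 (is_derive_cos w))) _.
  by rewrite /GRing.scale /= expr1; ring.
apply: is_derive_eq (@is_derive1_comp _ Num.sqrt (fun u => 1 + cos u ^+ 2) w _ _
  (is_derive1_sqrt radicand_gt0) radicand_der) _.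
by rewrite -/(disc w); field; exact: disc_neq0.
Qed.

Lemma is_derive_rho w : is_derive w 1 rho (rho w * dlog_rho w).
Proof.
apply: is_derive_eq (is_deriveB (is_derive_disc w) (is_derive_cos w)) _.
by rewrite /dlog_rho /rho; field; exact: disc_neq0.
Qed.

Lemma is_derive_ln_rho w : is_derive w 1 (fun u => ln (rho u)) (dlog_rho w).
Proof.
apply: is_derive_eq (@is_derive1_comp _ (@ln R) rho w _ _
  (is_derive1_ln (rho_gt0 w)) (is_derive_rho w)) _.
by rewrite mulKf // gt_eqF // rho_gt0.
Qed.

Local Open Scope complex_scope.

Definition contour w : R[i] := (rho w * cos w) +i* (rho w * sin w).
(* On the circle (1 - t) / (1 + t) is the conjugate of t, so that
   V = log ((1 + t) / (1 - t)) is minus the conjugate of U = log t. *)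
Definition logU w : R[i] := ln (rho w) +i* w.
Definition logV w : R[i] := (- ln (rho w)) +i* w.
Definition dU w : R[i] := dlog_rho w +i* 1.
Definition dV w : R[i] := (- dlog_rho w) +i* 1.

Lemma conj_dU w : (dU w)^*%C = - dV w.
Proof. by apply: complexP; rewrite /= ?opprK. Qed.

Lemma conj_dV w : (dV w)^*%C = - dU w.
Proof. by apply: complexP; rewrite /= ?opprK. Qed.

Lemma conj_logU w : (logU w)^*%C = - logV w.
Proof. by apply: complexP; rewrite /= ?opprK. Qed.

Lemma dV_contour w : dV w * (1 - contour w ^+ 2) = 2 * dU w * contour w.
Proof.
pose contourV : R[i] := ((rho w)^-1 * cos w) +i* (- ((rho w)^-1 * sin w)).
have cos2 : cos w ^+ 2 = 1 - sin w ^+ 2 by rewrite sin2cos2 subKr.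
have rho_neq0 : rho w != 0 by rewrite gt_eqF ?rho_gt0.
have contour_contourV : contour w * contourV = 1.
  apply: complexP; rewrite ?complexReM ?complexImM /=.
    transitivity (cos w ^+ 2 + sin w ^+ 2); first by field.
    exact: cos2Dsin2.
  by field.
suff dV_contourV : dV w * (contourV - contour w) = 2 * dU w.
  transitivity (dV w * (contourV - contour w) * contour w); last first.
    by rewrite dV_contourV.
  by rewrite -contour_contourV; ring.
have two : 2 = 2 +i* 0 :> R[i] by rewrite -(rmorph_nat (real_complex R)).
have := sqr_disc w; have := disc_neq0 w.
rewrite /contourV rhoV two /contour /dV /dU /dlog_rho /rho.
move: (disc w) => h h_neq0 sqr_h.
apply: complexP; rewrite ?complexReM ?complexImM !raddfB /=.
  transitivity (2 * sin w / h * (h ^+ 2 - cos w ^+ 2)); first by field.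
  by rewrite sqr_h; ring.
transitivity (2 * (sin w ^+ 2 + cos w ^+ 2)); first by field.
by rewrite cos2; ring.
Qed.

Lemma is_cderive_contour w : is_cderive w contour (contour w * dU w).
Proof.
split=> /=.
  apply: is_derive_eq (is_deriveM (is_derive_rho w) (is_derive_cos w)) _.
  by rewrite /GRing.scale /=; ring.
apply: is_derive_eq (is_deriveM (is_derive_rho w) (is_derive_sin w)) _.
by rewrite /GRing.scale /=; ring.
Qed.

Lemma is_cderive_contourX w n :
  is_cderive w (fun u => contour u ^+ n) (n%:R * contour w ^+ n * dU w).
Proof.
case: n => [|n].
  rewrite mul0r mul0r; under eq_fun do rewrite expr0.
  exact: is_cderive_cst.
apply: is_cderive_eq (is_cderiveX n (is_cderive_contour w)) _.
by rewrite exprSr !mulrA.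
Qed.

Lemma is_cderive_logU w : is_cderive w logU (dU w).
Proof. by split=> /=; [exact: is_derive_ln_rho|exact: is_derive_id]. Qed.

Lemma is_cderive_logV w : is_cderive w logV (dV w).
Proof.
by split=> /=; [exact: (is_deriveN (is_derive_ln_rho w))|exact: is_derive_id].
Qed.

End Contour.

(** * The truncated generating series along the contour *)

Section Reflection.
Variable R : realType.
Local Open Scope complex_scope.

Definition conj_coefs : fps2 R[i] -> fps2 R[i] := fps_map (fps_map conjc).

HB.instance Definition _ := GRing.RMorphism.copy conj_coefs
  (fps_map (fps_map (@conjc R))).

(* F(X, Y) is sent to the coefficientwise conjugate of F(-Y, -X). *)
Definition reflect_series : fps2 R[i] -> fps2 R[i] :=
  @fps2_swap _ \o fps2_scale (-1) (-1) \o conj_coefs.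

HB.instance Definition _ := GRing.RMorphism.copy reflect_series
  (@fps2_swap _ \o fps2_scale (-1) (-1) \o conj_coefs).

Lemma reflect_seriesE F a b :
  reflect_series F a b = (-1) ^+ (a + b) * (F b a)^*%C.
Proof. by rewrite /reflect_series /= /fps2_swap fps2_scaleE -exprD addnC. Qed.

Lemma reflect_X : reflect_series (fps2_X _) = - fps2_Y _.
Proof.
apply: fps2P => a b; rewrite reflect_seriesE fps2NE fps2_XE fps2_YE conjc_nat.
by case: a b => [|a] [|[|b]]; rewrite /= ?andbF ?mulr0 ?oppr0 // expr1 mulr1.
Qed.

Lemma reflect_Y : reflect_series (fps2_Y _) = - fps2_X _.
Proof.
apply: fps2P => a b; rewrite reflect_seriesE fps2NE fps2_XE fps2_YE conjc_nat.
by case: b a => [|b] [|[|a]]; rewrite /= ?andbF ?mulr0 ?oppr0 // expr1 mulr1.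
Qed.

Lemma reflect_const c : reflect_series (fps2_const c) = fps2_const c^*%C.
Proof.
apply: fps2P => a b; rewrite reflect_seriesE !fps2_constE andbC.
case: ifP => [/andP[/eqP-> /eqP->]|_]; first by rewrite expr0 mul1r.
by rewrite conjc0 mulr0.
Qed.

Lemma is_fps2_derive_reflect x (F : R -> fps2 R[i]) D : is_fps2_derive x F D ->
  is_fps2_derive x (fun t => reflect_series (F t)) (reflect_series D).
Proof.
move=> F_der a b; rewrite reflect_seriesE.
under eq_fun do rewrite reflect_seriesE.
by apply: is_cderiveZ; exact: is_cderiveJ.
Qed.

End Reflection.

Lemma summation_by_parts (A : comNzRingType) (g : nat -> A) (t u v : A) b N :
  v * (1 - t ^+ 2) = 2 * u * t ->
  \sum_(m < N.+1) 2 * u * (\sum_(i < m.+1) g i) * t ^+ (2 * m + b.+1) =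
  v * (\sum_(m < N.+1) g m * t ^+ (2 * m + b)
       - (\sum_(m < N.+1) g m) * t ^+ (2 * N + b).+2).
Proof.
move=> vut; pose G n := \sum_(m < n) g m.
have step n : 2 * u * G n.+1 * t ^+ (2 * n + b.+1) =
    v * G n.+1 * (t ^+ (2 * n + b) - t ^+ (2 * n + b).+2).
  rewrite addnS 3!exprS; transitivity (2 * u * t * G n.+1 * t ^+ (2 * n + b)).
    by ring.
  by rewrite -vut expr2; ring.
elim: N => [|N IH].
  by rewrite big_ord1 step [X in v * (X - _)]big_ord1 /G big_ord1; ring.
rewrite big_ord_recr [X in v * (X - _)]big_ord_recr /= IH step.
rewrite -/(G N.+1) -/(G N.+2) (_ : G N.+2 = G N.+1 + g N.+1); last first.
  exact: big_ord_recr.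
by rewrite mulnS !addSn add0n; ring.
Qed.

Section TruncatedSeries.
Variable R : realType.
Implicit Types (w : R) (a b N : nat).
Local Open Scope complex_scope.

Local Notation ws := (weight_sum R).
Local Notation X := (fps2_X R[i]).
Local Notation Y := (fps2_Y R[i]).
Local Notation C := (@fps2_const R[i]).

Definition partialA N w : fps2 R[i] := fun a b =>
  \sum_(m < N.+1) (2 ^+ b * ws a b m)%:C * contour w ^+ (2 * m + b).

Definition boundaryA N w : fps2 R[i] := fun a b =>
  (2 ^+ b * \sum_(m < N.+1) ws a b m)%:C * contour w ^+ (2 * N + b).+2.

Lemma partialA0 N w a : partialA N w a 0 = (a == 0%N)%:R.
Proof.
rewrite /partialA big_ord_recl big1 => [|m _]; last first.
  by rewrite weight_sum0 andbF mulr0 mul0r.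
by rewrite weight_sum0 andbT muln0 !expr0 !mul1r mulr1 addr0 rmorph_nat.
Qed.

Lemma dV_partialA N w a b : dV w * (partialA N w a b - boundaryA N w a b) =
  \sum_(m < N.+1) (2 ^+ b.+1 * \sum_(i < m.+1) ws a b i)%:C
    * contour w ^+ (2 * m + b.+1) * dU w.
Proof.
rewrite /partialA /boundaryA.
under eq_bigr do rewrite rmorphM -mulrA.
rewrite rmorphM rmorph_sum -mulrA -mulr_sumr -mulrBr mulrCA.
rewrite -(summation_by_parts (fun m => (ws a b m)%:C) b N (dV_contour w)).
rewrite mulr_sumr; apply: eq_bigr => m _.
rewrite exprS 2!rmorphM rmorph_nat rmorph_sum.
by rewrite [RHS]mulrC !mulrA; congr (_ * _); ring.
Qed.

Lemma is_fps2_derive_partialA N w : is_fps2_derive w (partialA N)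
  (C (dU w) * X * (partialA N w - 1)
   + C (dV w) * Y * (partialA N w - boundaryA N w)).
Proof.
move=> a [|b]; rewrite fps2DE -!mulrA !fps2_constME fps2_XME fps2_YME.
  rewrite mulr0 addr0; under eq_fun do rewrite partialA0.
  apply: is_cderive_eq (is_cderive_cst _ _) _; case: a => [|a].
    by rewrite mulr0.
  by rewrite fps2BE partialA0 fps2_1E andbT subrr mulr0.
apply: is_cderive_eq.
  by apply: is_cderive_sum => m; apply: is_cderiveZ; exact: is_cderive_contourX.
rewrite fps2BE dV_partialA.
have -> : (if a is a'.+1 then (partialA N w - 1) a' b.+1 else 0) =
    \sum_(m < N.+1) (2 ^+ b.+1 * (if a is a'.+1 then ws a' b.+1 m else 0))%:C
      * contour w ^+ (2 * m + b.+1).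
  case: a => [|a]; first by rewrite big1 // => m _; rewrite mulr0 mul0r.
  by rewrite fps2BE fps2_1E andbF subr0.
rewrite mulr_sumr -big_split; apply: eq_bigr => m _ /=.
rewrite [in RHS]mulrC -!mulrDl -rmorphD -mulrDr -weight_sum_step.
by rewrite !rmorphM rmorph_nat; ring.
Qed.

Definition symA N w : fps2 R[i] :=
  partialA N w + reflect_series (partialA N w) - 1.

Definition boundary_symA N w : fps2 R[i] :=
  C (dV w) * Y * boundaryA N w + C (dU w) * X * reflect_series (boundaryA N w).

Lemma is_fps2_derive_symA N w : is_fps2_derive w (symA N)
  ((C (dU w) * X + C (dV w) * Y) * symA N w - boundary_symA N w).
Proof.
have A_der := is_fps2_derive_partialA N w.
apply: is_fps2_derive_eq (is_fps2_deriveD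
  (is_fps2_deriveD A_der (is_fps2_derive_reflect A_der))
  (is_fps2_derive_cst w (-1))) _.
rewrite rmorphD !rmorphM !rmorphB rmorph1 /=.
rewrite !reflect_const reflect_X reflect_Y.
by rewrite conj_dU conj_dV !rmorphN /boundary_symA /symA; ring.
Qed.

Definition twist_factor w : fps2 R[i] :=
  in_X (fps_exp (- logU w)) * in_Y (fps_exp (- logV w)).

Lemma is_fps2_derive_twist_factor w : is_fps2_derive w twist_factor
  (- (C (dU w) * X + C (dV w) * Y) * twist_factor w).
Proof.
apply: is_fps2_derive_eq (is_fps2_deriveM
  (is_fps2_derive_exp_X (is_cderiveN (is_cderive_logU w)))
  (is_fps2_derive_exp_Y (is_cderiveN (is_cderive_logV w)))) _.
by rewrite /twist_factor !rmorphN; move: (in_X _) (in_Y _) => eX eY; ring.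
Qed.

Definition twisted N w : fps2 R[i] := twist_factor w * symA N w.

Lemma is_fps2_derive_twisted N w :
  is_fps2_derive w (twisted N) (- (twist_factor w * boundary_symA N w)).
Proof.
apply: is_fps2_derive_eq
  (is_fps2_deriveM (is_fps2_derive_twist_factor w) (is_fps2_derive_symA N w)) _.
by ring.
Qed.

End TruncatedSeries.

(** * Estimates along the contour *)

Section MeanValue.
Variable R : realType.

Lemma is_derive_ge0_le (f df : R -> R) (x y : R) : x <= y ->
  (forall u : R, x <= u <= y -> is_derive u 1 f (df u)) ->
  (forall u, x <= u <= y -> 0 <= df u) -> f x <= f y.
Proof.
move=> x_le_y f_der df_ge0.
have [u u_xy||c] := @MVT_segment _ f df x y x_le_y.
- apply: f_der; apply/andP; move: u_xy; rewrite in_itv /= => /andP[? ?].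
  by split; exact: ltW.
- apply: derivable_within_continuous => u; rewrite in_itv /= => u_xy.
  exact: (@ex_derive _ _ _ _ _ _ _ (f_der u u_xy)).
rewrite in_itv /= => /df_ge0 dfc fE.
by rewrite -subr_ge0 fE mulr_ge0 // subr_ge0.
Qed.

Lemma is_derive_normB_le (f df g dg : R -> R) (x y : R) : x <= y ->
  (forall u : R, x <= u <= y -> is_derive u 1 f (df u)) ->
  (forall u : R, x <= u <= y -> is_derive u 1 g (dg u)) ->
  (forall u, x <= u <= y -> `|df u| <= dg u) -> `|f y - f x| <= g y - g x.
Proof.
move=> x_le_y f_der g_der df_le; rewrite ler_norml; apply/andP; split.
  have : (g + f) x <= (g + f) y.
    apply: (@is_derive_ge0_le _ (fun u => dg u + df u)) => // u u_xy.
      exact: (is_deriveD (g_der u u_xy) (f_der u u_xy)).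
    by have := df_le u u_xy; rewrite ler_norml => /andP[]; lra.
  by rewrite !fctE; lra.
have : (g - f) x <= (g - f) y.
  apply: (@is_derive_ge0_le _ (fun u => dg u - df u)) => // u u_xy.
    exact: (is_deriveB (g_der u u_xy) (f_der u u_xy)).
  by have := df_le u u_xy; rewrite ler_norml => /andP[]; lra.
by rewrite !fctE; lra.
Qed.

End MeanValue.

Section RhoEstimates.
Variable R : realType.
Implicit Types (w : R) (N : nat).

Lemma quarter_cos_ge0 w : 0 <= w <= pi / 2 -> 0 <= cos w.
Proof.
move=> /andP[w_ge0 w_le]; apply: cos_ge0_pihalf; rewrite w_le andbT.
by apply: le_trans w_ge0; rewrite oppr_le0 divr_ge0 ?pi_ge0.
Qed.

Lemma quarter_sin_ge0 w : 0 <= w <= pi / 2 -> 0 <= sin w.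
Proof.
move=> /andP[w_ge0 w_le]; apply: sin_ge0_pi; rewrite w_ge0 /=.
by apply: le_trans w_le _; have := @pi_ge0 R; lra.
Qed.

Lemma rhoV_ge1 w : 0 <= w <= pi / 2 -> 1 <= (rho w)^-1.
Proof. by move=> /quarter_cos_ge0; rewrite rhoV; have := disc_ge1 w; lra. Qed.

Lemma rho_le1 w : 0 <= w <= pi / 2 -> rho w <= 1.
Proof. by move=> /rhoV_ge1; rewrite invf_ge1 ?rho_gt0. Qed.

Lemma rhoV_le3 w : (rho w)^-1 <= 3.
Proof.
have disc_le2 : disc w <= 2.
  rewrite -(@ler_pXn2r _ 2) ?nnegrE ?(ltW (disc_gt0 w)) // sqr_disc.
  have := sqr_ge0 (sin w); rewrite sin2cos2; lra.
by rewrite rhoV; have := cos_le1 w; lra.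
Qed.

Lemma dlog_rho_ge_half_or_sqr_rho_le w : 0 <= w <= pi / 2 ->
  2^-1 <= dlog_rho w \/ rho w ^+ 2 <= 2^-1.
Proof.
move=> w_quarter; have cos_ge0 := quarter_cos_ge0 w_quarter.
have sin_ge0 := quarter_sin_ge0 w_quarter.
have [disc_le|disc_gt] := leP (disc w) (2 * sin w).
  by left; rewrite ler_pdivlMr ?disc_gt0 //; lra.
right; have sin_small : 4 * sin w ^+ 2 <= disc w ^+ 2.
  rewrite (_ : 4 * _ = (2 * sin w) ^+ 2); last by ring.
  by rewrite lerXn2r ?nnegrE ?mulr_ge0 ?(ltW disc_gt) // ltW ?disc_gt0.
rewrite -[_ ^+ 2]invrK lef_pV2 ?posrE ?invr_gt0 ?exprn_gt0 ?rho_gt0 //.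
rewrite -exprVn rhoV sqrrD.
have : cos w ^+ 2 <= disc w * cos w.
  rewrite expr2 ler_wpM2r // -(@ler_pXn2r _ 2) ?nnegrE ?(ltW (disc_gt0 w)) //.
  by rewrite sqr_disc lerDr.
by move: sin_small; rewrite sqr_disc sin2cos2 mulr2n; lra.
Qed.

(* The powers of rho concentrate near the endpoint pi / 2, where rho grows at a
   definite rate; elsewhere rho^2 <= 1 / 2. *)
Definition rho_primitive N w : R :=
  N.+1%:R^-1 * rho w ^+ (2 * N.+1) + 2^-1 ^+ N.+1 * w.

Definition drho_primitive N w : R :=
  2 * rho w ^+ (2 * N.+1) * dlog_rho w + 2^-1 ^+ N.+1.

Lemma is_derive_rho_primitive N w :
  is_derive w 1 (rho_primitive N) (drho_primitive N w).
Proof.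
have -> : rho_primitive N =
    N.+1%:R^-1 *: (@rho R) ^+ (2 * N.+1) + 2^-1 ^+ N.+1 *: id.
  by apply: funext => u; rewrite /rho_primitive !fctE.
apply: is_derive_eq (is_deriveD (is_deriveZ N.+1%:R^-1
  (is_deriveX (2 * N.+1) (is_derive_rho w)))
  (is_deriveZ (2^-1 ^+ N.+1) (is_derive_id w 1))) _.
rewrite /GRing.scale /= /drho_primitive mulr1; congr (_ + _).
rewrite -[in RHS](@prednK (2 * N.+1)) // exprSr natrM.
have : N.+1%:R != 0 :> R by rewrite pnatr_eq0.
by move: (N.+1%:R : R) => c c_neq0; field.
Qed.

Lemma rho_exp_le N w : 0 <= w <= pi / 2 ->
  rho w ^+ (2 * N.+1) <= drho_primitive N w.
Proof.
move=> w_quarter; have rho_ge0 := ltW (rho_gt0 w); rewrite /drho_primitive.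
have rhoX_ge0 : 0 <= rho w ^+ (2 * N.+1) by rewrite exprn_ge0.
have dlog_ge0 : 0 <= dlog_rho w.
  by rewrite divr_ge0 ?quarter_sin_ge0 // ltW ?disc_gt0.
have [dlog_ge|sqr_rho_le] := dlog_rho_ge_half_or_sqr_rho_le w_quarter.
  apply: (@le_trans _ _ (2 * rho w ^+ (2 * N.+1) * dlog_rho w)).
    by have := ler_wpM2l rhoX_ge0 dlog_ge; lra.
  by rewrite lerDl exprn_ge0.
apply: (@le_trans _ _ (2^-1 ^+ N.+1)); last first.
  by rewrite lerDr mulr_ge0 // mulr_ge0.
by rewrite exprM lerXn2r ?nnegrE ?sqr_ge0.
Qed.

Lemma rho_pihalf : rho (pi / 2 : R) = 1.
Proof. by rewrite /rho /disc cos_pihalf expr0n addr0 sqrtr1 subr0. Qed.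

Lemma rho_primitive_increment_le N :
  rho_primitive N (pi / 2) - rho_primitive N 0 <= 3 / N.+1%:R.
Proof.
have pow2_le : 2^-1 ^+ N.+1 <= N.+1%:R^-1 :> R.
  rewrite exprVn lef_pV2 ?posrE ?ltr0n ?exprn_gt0 // -natrX ler_nat.
  by apply: ltnW; exact: ltn_expl.
have : 2^-1 ^+ N.+1 * (pi / 2) <= N.+1%:R^-1 * 2 :> R.
  apply: ler_pM; rewrite ?exprn_ge0 ?divr_ge0 ?pi_ge0 //.
  exact/ltW/pihalf_lt2.
have : 0 <= N.+1%:R^-1 * rho 0 ^+ (2 * N.+1) :> R.
  by rewrite mulr_ge0 ?exprn_ge0 // ltW ?rho_gt0.
rewrite /rho_primitive rho_pihalf expr1n mulr0 addr0 mulr1.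
by move: (N.+1%:R^-1) (2^-1 ^+ _ * _) (rho 0 ^+ _) => c d r; lra.
Qed.

Definition decay N w : R := Num.sqrt N.+1%:R * rho w ^+ (2 * N.+1).

Lemma decay_endpoint_le N (f df : R -> R) (C : R) : 0 <= C -> f 0 = 0 ->
  (forall u : R, is_derive u 1 f (df u)) ->
  (forall u, 0 <= u <= pi / 2 -> `|df u| <= C * decay N u) ->
  `|f (pi / 2)| <= 3 * C * (Num.sqrt N.+1%:R)^-1.
Proof.
move=> C_ge0 f0 f_der df_le; set s : R := Num.sqrt N.+1%:R.
have s_gt0 : 0 < s by rewrite sqrtr_gt0 ltr0n.
have pihalf_ge0 : 0 <= pi / 2 :> R by rewrite divr_ge0 ?pi_ge0.
have Cs_ge0 : 0 <= C * s by rewrite mulr_ge0 // ltW.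
rewrite -[f _]subr0 -f0.
apply: (@le_trans _ _ (C * s * rho_primitive N (pi / 2)
                       - C * s * rho_primitive N 0)).
  apply: (@is_derive_normB_le _ f df (fun u => C * s * rho_primitive N u)
    (fun u => C * s * drho_primitive N u) _ _ pihalf_ge0) => u u_quarter.
  - exact: (is_deriveZ (C * s) (is_derive_rho_primitive N u)).
  - apply: le_trans (df_le u u_quarter) _.
    by rewrite /decay mulrA ler_wpM2l ?rho_exp_le.
rewrite -mulrBr.
apply: le_trans (ler_wpM2l Cs_ge0 (rho_primitive_increment_le N)) _.
rewrite -[N.+1%:R](@sqr_sqrtr R) ?ler0n // -/s le_eqVlt; apply/orP; left.
by apply/eqP; field; rewrite gt_eqF.
Qed.

End RhoEstimates.

Section Domination.
Variable R : realType.
Implicit Types (w : R) (a b N : nat) (z : R[i]) (h : nat -> R -> R).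
Local Open Scope complex_scope.

Local Notation Re := (@complex.Re R).
Local Notation Im := (@complex.Im R).

Lemma norm_le_ReIm z : `|z| <= (`|Re z| + `|Im z|)%:C.
Proof.
rewrite normc_def lecR -[leRHS]ger0_norm ?addr_ge0 // -sqrtr_sqr.
rewrite ler_sqrt ?sqr_ge0 //.
rewrite -(real_normK (num_real (Re z))) -(real_normK (num_real (Im z))).
by rewrite sqrrD addrAC lerDl mulrn_wge0 // mulr_ge0.
Qed.

Lemma Im_le_norm z (r : R) : `|z| <= r%:C -> `|Im z| <= r.
Proof.
rewrite normc_def lecR; apply: le_trans.
by rewrite -sqrtr_sqr ler_sqrt ?lerDr ?addr_ge0 ?sqr_ge0.
Qed.

Lemma norm_real_complex (x : R) : `|x%:C| = `|x|%:C.
Proof. by rewrite normc_def /= expr0n addr0 sqrtr_sqr. Qed.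

Lemma norm_contour w : `|contour w| = (rho w)%:C.
Proof.
rewrite normc_def /= !exprMn -mulrDr cos2Dsin2 mulr1 sqrtr_sqr ger0_norm //.
exact/ltW/rho_gt0.
Qed.

Definition dominated h (f : nat -> R -> R[i]) :=
  exists2 C : R, 0 <= C & forall N w, 0 <= w <= pi / 2 ->
    `|f N w| <= (C * h N w)%:C.

Definition bounded (f : R -> R[i]) := dominated (fun _ _ => 1) (fun=> f).

Lemma boundedP (f : R -> R[i]) (B : R) : 0 <= B ->
  (forall w, 0 <= w <= pi / 2 -> `|f w| <= B%:C) -> bounded f.
Proof.
by move=> B_ge0 f_le; exists B => // N w; rewrite mulr1; exact: f_le.
Qed.

Lemma eq_bounded (f g : R -> R[i]) : f =1 g -> bounded f -> bounded g.
Proof. by move=> /funext ->. Qed.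

Lemma dominated0 h : dominated h (fun _ _ => 0).
Proof. by exists 0 => // N w _; rewrite normr0 mul0r. Qed.

Lemma bounded_cst z : bounded (fun=> z).
Proof.
apply: (@boundedP _ (`|Re z| + `|Im z|)); first by rewrite addr_ge0.
by move=> w _; exact: norm_le_ReIm.
Qed.

Lemma dominatedD h f g : dominated h f -> dominated h g ->
  dominated h (fun N w => f N w + g N w).
Proof.
move=> [C C_ge0 f_le] [D D_ge0 g_le]; exists (C + D); first by rewrite addr_ge0.
move=> N w w_quarter; rewrite mulrDl rmorphD.
by apply: le_trans (ler_normD _ _) _; apply: lerD; [exact: f_le|exact: g_le].
Qed.

Lemma dominatedM h f g : bounded f -> dominated h g ->
  dominated h (fun N w => f w * g N w).
Proof.
move=> [C C_ge0 f_le] [D D_ge0 g_le]; exists (C * D); first by rewrite mulr_ge0.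
move=> N w w_quarter; rewrite normrM -mulrA rmorphM; apply: ler_pM => //.
  by have := f_le N w w_quarter; rewrite mulr1.
exact: g_le.
Qed.

Lemma dominatedN h f : dominated h f -> dominated h (fun N w => - f N w).
Proof.
by move=> [C C_ge0 f_le]; exists C => // N w w_quarter; rewrite normrN f_le.
Qed.

Lemma dominatedJ h f : dominated h f -> dominated h (fun N w => (f N w)^*%C).
Proof.
by move=> [C C_ge0 f_le]; exists C => // N w w_quarter; rewrite normcJ f_le.
Qed.

Lemma dominated_sum h n (f : 'I_n -> nat -> R -> R[i]) :
  (forall i, dominated h (f i)) ->
  dominated h (fun N w => \sum_(i < n) f i N w).
Proof.
elim: n f => [|n IH] f f_dom.
  under eq_fun do under eq_fun do rewrite big_ord0.
  exact: dominated0.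
under eq_fun do under eq_fun do rewrite big_ord_recl.
by apply: dominatedD => //; apply: IH.
Qed.

Lemma boundedX f n : bounded f -> bounded (fun w => f w ^+ n).
Proof.
move=> f_bd; elim: n => [|n IH]; first exact: bounded_cst.
apply: eq_bounded (dominatedM f_bd IH) => w; exact: esym (exprS _ _).
Qed.

Lemma bounded_fps_exp f n : bounded f -> bounded (fun w => fps_exp (- f w) n).
Proof.
move=> f_bd; apply: (@eq_bounded (fun w => (n`!%:R)^-1 * (- f w) ^+ n)) => [w|].
  exact: mulrC.
by apply: dominatedM; [exact: bounded_cst|apply: boundedX; exact: dominatedN].
Qed.

Lemma bounded_dU : bounded (@dU R).
Proof.
apply: (@boundedP _ 2) => // w _; apply: le_trans (norm_le_ReIm _) _.
rewrite lecR /= normr1; suff : `|dlog_rho w| <= 1 by lra.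
rewrite normrM normfV (ger0_norm (ltW (disc_gt0 w))).
rewrite ler_pdivrMr ?disc_gt0 // mul1r.
exact: le_trans (sin_max w) (disc_ge1 w).
Qed.

Lemma bounded_dV : bounded (@dV R).
Proof.
apply: eq_bounded (dominatedN (dominatedJ bounded_dU)) => w.
by rewrite conj_dU opprK.
Qed.

Lemma bounded_logU : bounded (@logU R).
Proof.
apply: (@boundedP _ 5) => // w w_quarter; apply: le_trans (norm_le_ReIm _) _.
rewrite lecR /=; have /andP[w_ge0 w_le] := w_quarter.
rewrite (ger0_norm w_ge0) -[rho w]invrK lnV ?posrE ?invr_gt0 ?rho_gt0 //.
rewrite normrN ger0_norm ?ln_ge0 ?rhoV_ge1 //.
have rhoV_gt0 : 0 < (rho w)^-1 by rewrite invr_gt0 rho_gt0.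
have := ln_sublinear rhoV_gt0; have := rhoV_le3 w; have := pihalf_lt2 R.
by lra.
Qed.

Lemma bounded_logV : bounded (@logV R).
Proof.
apply: eq_bounded (dominatedN (dominatedJ bounded_logU)) => w.
by rewrite conj_logU opprK.
Qed.

Lemma dominated_boundaryA a b :
  dominated (@decay R) (fun N w => boundaryA N w a b).
Proof.
have [C C_ge0 sum_le] := sum_weight_sum_le R a b.
exists (2 ^+ b * C) => [|N w w_quarter]; first by rewrite !mulr_ge0 ?exprn_ge0.
rewrite normrM norm_real_complex normrX norm_contour.
rewrite -(rmorphXn (real_complex R)) -(rmorphM (real_complex R)) lecR.
have rho_ge0 := ltW (rho_gt0 w).
have sum_ge0 := sum_weight_sum_ge0 R a b N.+1.
rewrite ger0_norm ?mulr_ge0 ?exprn_ge0 // /decay -mulrA.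
rewrite mulrA [leRHS]mulrA -[2 ^+ b * C * _]mulrA; apply: ler_pM.
- by rewrite mulr_ge0 ?exprn_ge0.
- by rewrite exprn_ge0.
- by rewrite ler_wpM2l ?exprn_ge0.
- by rewrite ler_wiXn2l ?rho_le1 //; lia.
Qed.

Definition fps2_dominated h (F : nat -> R -> fps2 R[i]) :=
  forall a b, dominated h (fun N w => F N w a b).

Definition fps2_bounded (F : R -> fps2 R[i]) :=
  fps2_dominated (fun _ _ => 1) (fun=> F).

Lemma fps2_dominatedD h F G : fps2_dominated h F -> fps2_dominated h G ->
  fps2_dominated h (fun N w => F N w + G N w).
Proof. by move=> F_dom G_dom a b; exact: dominatedD. Qed.

Lemma fps2_dominatedM h F G : fps2_bounded F -> fps2_dominated h G ->
  fps2_dominated h (fun N w => F w * G N w).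
Proof.
move=> F_bd G_dom a b; under eq_fun do under eq_fun do rewrite fps2ME.
apply: dominated_sum => i; apply: dominated_sum => j.
by apply: dominatedM; [exact: F_bd|exact: G_dom].
Qed.

Lemma fps2_bounded_cst F : fps2_bounded (fun=> F).
Proof. by move=> a b; exact: bounded_cst. Qed.

Lemma fps2_bounded_const f :
  bounded f -> fps2_bounded (fun w => fps2_const (f w)).
Proof.
move=> f_bd a b.
apply: (@eq_bounded (fun w => if (a == 0%N) && (b == 0%N) then f w else 0)).
  by move=> w; rewrite fps2_constE.
by case: (_ && _); [exact: f_bd|exact: bounded_cst].
Qed.

Lemma fps2_dominated_reflect h F : fps2_dominated h F ->
  fps2_dominated h (fun N w => reflect_series (F N w)).
Proof.
move=> F_dom a b; under eq_fun do under eq_fun do rewrite reflect_seriesE.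
by apply: dominatedM; [exact: bounded_cst|exact: dominatedJ].
Qed.

Lemma fps2_bounded_twist_factor : fps2_bounded (@twist_factor R).
Proof.
apply: fps2_dominatedM => a b.
  by case: b => [|b]; [exact: bounded_fps_exp bounded_logU|exact: bounded_cst].
by case: a => [|a]; [exact: bounded_fps_exp bounded_logV|exact: bounded_cst].
Qed.

Lemma fps2_dominated_boundary_symA :
  fps2_dominated (@decay R) (@boundary_symA R).
Proof.
apply: fps2_dominatedD; apply: fps2_dominatedM.
- apply: fps2_dominatedM; last exact: fps2_bounded_cst.
  exact: fps2_bounded_const bounded_dV.
- exact: dominated_boundaryA.
- apply: fps2_dominatedM; last exact: fps2_bounded_cst.
  exact: fps2_bounded_const bounded_dU.
- exact: fps2_dominated_reflect dominated_boundaryA.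
Qed.

Lemma fps2_dominated_dtwisted :
  fps2_dominated (@decay R) (fun N w => - (twist_factor w * boundary_symA N w)).
Proof.
move=> a b; apply: dominatedN.
exact: (fps2_dominatedM fps2_bounded_twist_factor fps2_dominated_boundary_symA).
Qed.

End Domination.

(** * The endpoint t = i *)

Section ComplexLimits.
Variable R : realType.
Local Open Scope complex_scope.
Local Open Scope classical_set_scope.

Local Notation Re := (@complex.Re R).
Local Notation Im := (@complex.Im R).
Implicit Types (f g : nat -> R[i]) (l m c : R[i]).

Definition ccvg f l :=
  (Re (f n) @[n --> \oo] --> Re l) /\ (Im (f n) @[n --> \oo] --> Im l).

Lemma ccvg_cst c : ccvg (fun=> c) c.
Proof. by split; exact: cvg_cst. Qed.

Lemma ccvg_real (x : nat -> R) (l : R) : x n @[n --> \oo] --> l ->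
  ccvg (fun n => (x n)%:C) l%:C.
Proof. by move=> x_cvg; split => //=; exact: cvg_cst. Qed.

Lemma ccvgD f g l m : ccvg f l -> ccvg g m -> ccvg (fun n => f n + g n) (l + m).
Proof.
move=> [fr fi] [gr gi]; split; rewrite raddfD /=.
  by under eq_fun do rewrite raddfD; exact: cvgD.
by under eq_fun do rewrite raddfD; exact: cvgD.
Qed.

Lemma ccvgZ c f l : ccvg f l -> ccvg (fun n => c * f n) (c * l).
Proof.
move=> [fr fi]; split; rewrite ?complexReM ?complexImM.
  by under eq_fun do rewrite complexReM; apply: cvgB; exact: cvgMl_tmp.
by under eq_fun do rewrite complexImM; apply: cvgD; exact: cvgMl_tmp.
Qed.

Lemma ccvgJ f l : ccvg f l -> ccvg (fun n => (f n)^*%C) l^*%C.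
Proof.
move=> [fr fi]; split; rewrite ?complexReJ ?complexImJ.
  by under eq_fun do rewrite complexReJ.
by under eq_fun do rewrite complexImJ; exact: cvgN.
Qed.

Lemma ccvg_sum k (f : 'I_k -> nat -> R[i]) (l : 'I_k -> R[i]) :
  (forall i, ccvg (f i) (l i)) ->
  ccvg (fun n => \sum_(i < k) f i n) (\sum_(i < k) l i).
Proof.
elim: k f l => [|k IH] f l f_cvg.
  by rewrite big_ord0; under eq_fun do rewrite big_ord0; exact: ccvg_cst.
rewrite big_ord_recl; under eq_fun do rewrite big_ord_recl.
by apply: ccvgD => //; apply: IH.
Qed.

Definition fps2_cvg (F : nat -> fps2 R[i]) (L : fps2 R[i]) :=
  forall a b, ccvg (fun n => F n a b) (L a b).

Lemma fps2_cvgD F G L M : fps2_cvg F L -> fps2_cvg G M ->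
  fps2_cvg (fun n => F n + G n) (L + M).
Proof. by move=> F_cvg G_cvg a b; exact: ccvgD. Qed.

Lemma fps2_cvgZ C F L : fps2_cvg F L -> fps2_cvg (fun n => C * F n) (C * L).
Proof.
move=> F_cvg a b; rewrite fps2ME; under eq_fun do rewrite fps2ME.
by apply: ccvg_sum => i; apply: ccvg_sum => j; exact: ccvgZ.
Qed.

Lemma fps2_cvg_reflect F L : fps2_cvg F L ->
  fps2_cvg (fun n => reflect_series (F n)) (reflect_series L).
Proof.
move=> F_cvg a b; rewrite reflect_seriesE.
by under eq_fun do rewrite reflect_seriesE; apply: ccvgZ; exact: ccvgJ.
Qed.

End ComplexLimits.

Section Endpoint.
Variable R : realType.
Implicit Types (a b N : nat).
Local Open Scope complex_scope.
Local Open Scope classical_set_scope.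

Local Notation Im := (@complex.Im R).

Lemma conj_coefsE (F : fps2 R[i]) a b : conj_coefs F a b = (F a b)^*%C.
Proof. by []. Qed.

Lemma conj_coefs_in_X_exp (z : R[i]) :
  conj_coefs (in_X (fps_exp z)) = in_X (fps_exp z^*%C).
Proof.
apply: fps2P => a [|b]; last exact: conjc0.
by rewrite conj_coefsE !in_XE /fps_exp rmorphM rmorphXn fmorphV rmorph_nat.
Qed.

Lemma conj_coefs_in_Y_exp (z : R[i]) :
  conj_coefs (in_Y (fps_exp z)) = in_Y (fps_exp z^*%C).
Proof.
apply: fps2P => -[|a] b; last exact: conjc0.
by rewrite conj_coefsE !in_YE /fps_exp rmorphM rmorphXn fmorphV rmorph_nat.
Qed.

Lemma conj_coefs_reflect (F : fps2 R[i]) :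
  conj_coefs (reflect_series F) = reflect_series (conj_coefs F).
Proof.
apply: fps2P => a b; rewrite reflect_seriesE !conj_coefsE reflect_seriesE.
by rewrite rmorphM rmorphXn rmorphN1.
Qed.

Lemma conj_coefs_twisted0 N : conj_coefs (twisted N 0) = twisted N (0 : R).
Proof.
have conj_contour0 : (contour 0)^*%C = contour (0 : R).
  by apply: complexP; rewrite //= sin0 mulr0 oppr0.
have conj_NlogU0 : (- logU 0)^*%C = - logU (0 : R).
  by apply: complexP; rewrite //= !oppr0.
have conj_NlogV0 : (- logV 0)^*%C = - logV (0 : R).
  by apply: complexP; rewrite //= !oppr0.
have conj_partialA0 : conj_coefs (partialA N 0) = partialA N (0 : R).
  apply: fps2P => a b; rewrite conj_coefsE rmorph_sum; apply: eq_bigr => m _.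
  rewrite rmorphM rmorphXn; congr (_ * _ ^+ _); first exact: conjc_real.
  exact: conj_contour0.
rewrite /twisted /twist_factor /symA !rmorphM rmorphB rmorphD rmorph1 /=.
rewrite conj_coefs_reflect conj_partialA0.
by rewrite conj_coefs_in_X_exp conj_coefs_in_Y_exp conj_NlogU0 conj_NlogV0.
Qed.

Lemma Im_twisted0 N a b : Im (twisted N (0 : R) a b) = 0.
Proof.
have := conj_coefs_twisted0 N => /(congr1 (fun F : fps2 R[i] => Im (F a b))).
by rewrite conj_coefsE complexImJ; lra.
Qed.

Definition depth_series (x : nat -> nat -> R) : fps2 R[i] :=
  fun a b => (x a b)%:C * (- 'i%C) ^+ b.

Definition sym_series (x : nat -> nat -> R) : fps2 R[i] :=
  depth_series x + reflect_series (depth_series x) - 1.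

Definition quarter_turn : R[i] := 'i%C * (pi / 2)%:C.
Definition half_turn : R[i] := 'i%C * pi%:C.

Lemma half_turn_neq0 : half_turn != 0.
Proof.
by rewrite mulf_neq0 // eq_complex /= ?oner_eq0 ?andbF ?(gt_eqF (pi_gt0 R)).
Qed.

Lemma half_turnE : half_turn = quarter_turn + quarter_turn.
Proof. by rewrite /quarter_turn -mulrDr -rmorphD -splitr. Qed.

Definition endpoint_twist : fps2 R[i] :=
  in_X (fps_exp (- quarter_turn)) * in_Y (fps_exp (- quarter_turn)).

Lemma partialA_pihalf N : partialA N (pi / 2) = depth_series (W_partial R N).
Proof.
have contour_pihalf : contour (pi / 2 : R) = 'i%C.
  by rewrite /contour rho_pihalf cos_pihalf sin_pihalf mulr0 mulr1.
apply: fps2P => a b; rewrite /partialA /depth_series /W_partial contour_pihalf.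
rewrite mulr_sumr rmorph_sum mulr_suml; apply: eq_bigr => m _.
rewrite exprD exprM sqr_i [(- 'i%C) ^+ b]exprNn [(-2) ^+ b]exprNn.
rewrite !rmorphM !rmorphXn rmorphN1 /=.
have sign_sign : (-1) ^+ b * (-1) ^+ b = 1 :> R[i] by rewrite -expr2 sqrr_sign.
by rewrite -[LHS]mul1r -[X in X * _ = _]sign_sign; ring.
Qed.

Lemma twisted_pihalf N :
  twisted N (pi / 2) = endpoint_twist * sym_series (W_partial R N).
Proof.
have logU_pihalf : logU (pi / 2 : R) = quarter_turn.
  by rewrite /logU rho_pihalf ln1; apply: complexP => /=; ring.
have logV_pihalf : logV (pi / 2 : R) = quarter_turn.
  by rewrite /logV rho_pihalf ln1; apply: complexP => /=; ring.
by rewrite /twisted /symA partialA_pihalf /twist_factor logU_pihalf logV_pihalf.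
Qed.

Lemma Im_twisted_pihalf_cvg0 a b :
  Im (twisted N (pi / 2) a b) @[N --> \oo] --> (0 : R).
Proof.
have [C C_ge0 dtwisted_le] := fps2_dominated_dtwisted R a b.
apply: norm_cvg0; apply: (@squeeze_cvgr _ _ _ _ (fun=> 0)
  (fun N => 3 * C * (Num.sqrt N.+1%:R)^-1)).
- near=> N; rewrite normr_ge0 /=.
  apply: (@decay_endpoint_le _ N (fun u => Im (twisted N u a b))
    (fun u => Im ((- (twist_factor u * boundary_symA N u) : fps2 _) a b))
    C C_ge0 (Im_twisted0 N a b)) => u.
  + by have [] := is_fps2_derive_twisted N u a b.
  + by move=> u_quarter; apply: Im_le_norm; exact: dtwisted_le.
- exact: cvg_cst.
- rewrite -[X in _ --> X](mulr0 (3 * C)).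
  by apply: cvgMl_tmp; exact: cvg_inv_sqrt.
Unshelve. all: by end_near. Qed.

Lemma fps2_cvg_twisted_pihalf :
  fps2_cvg (fun N => twisted N (pi / 2))
    (endpoint_twist * sym_series (W_coef R)).
Proof.
under eq_fun do rewrite twisted_pihalf; apply: fps2_cvgZ.
have depth_cvg : fps2_cvg (fun N => depth_series (W_partial R N))
    (depth_series (W_coef R)).
  move=> a b; rewrite /depth_series mulrC; under eq_fun do rewrite mulrC.
  by apply: ccvgZ; apply: ccvg_real; exact: W_partial_cvg.
apply: fps2_cvgD; last by move=> a b; exact: ccvg_cst.
by apply: fps2_cvgD => //; exact: fps2_cvg_reflect.
Qed.

Lemma conj_coefs_endpoint :
  conj_coefs (endpoint_twist * sym_series (W_coef R)) =
  endpoint_twist * sym_series (W_coef R).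
Proof.
apply: fps2P => a b; rewrite conj_coefsE.
have [_ Im_cvg] := fps2_cvg_twisted_pihalf a b.
have Im0 : Im ((endpoint_twist * sym_series (W_coef R) : fps2 _) a b) = 0.
  by rewrite -(cvg_lim _ Im_cvg) // (cvg_lim _ (Im_twisted_pihalf_cvg0 a b)).
by apply: complexP; rewrite ?complexReJ ?complexImJ ?Im0 ?oppr0.
Qed.

End Endpoint.

(** * The symmetry relation *)

Lemma sum_even_odd (V : nmodType) (F : nat -> V) (n : nat) :
  \sum_(i < n) F i =
  \sum_(i < uphalf n) F (2 * i)%N + \sum_(i < n./2) F (2 * i).+1.
Proof.
elim: n => [|n IH]; first by rewrite !big_ord0 addr0.
have Fn : F n = F (odd n + 2 * n./2)%N by rewrite mul2n odd_double_half.
rewrite big_ord_recr IH /= Fn uphalf_half.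
case: (odd n); first by rewrite add1n [X in _ = _ + X]big_ord_recr addrA.
by rewrite add0n [X in _ = X + _]big_ord_recr addrAC.
Qed.

Section ParityElimination.
Variables (K : numFieldType) (c : K) (S : fps2 K).

Let p := in_X (fps_exp c).
Let q := in_Y (fps_exp c).
Let pV := in_X (fps_exp (- c)).
Let qV := in_Y (fps_exp (- c)).

Hypothesis S_eq : S = p * q * fps2_scale (-1) (-1) S.
Hypothesis S_odd_odd : forall a b, odd a -> odd b -> S a b = 0.

Let ppV : p * pV = 1.
Proof. by rewrite -rmorphM fps_expN rmorph1. Qed.

Let qqV : q * qV = 1.
Proof. by rewrite -rmorphM fps_expN rmorph1. Qed.

Lemma flip_Y_eq : fps2_scale 1 (-1) S = p * qV * fps2_scale (-1) 1 S.
Proof.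
rewrite {1}S_eq !rmorphM /= fps2_scale_in_X fps2_scale_in_Y !fps_scale_exp.
by rewrite fps2_scaleM !mul1r mulrNN mulr1 mulN1r.
Qed.

Lemma flip_XY_eq :
  fps2_scale (-1) (-1) S = fps2_scale (-1) 1 S + fps2_scale 1 (-1) S - S.
Proof.
apply: fps2P => a b; rewrite fps2BE fps2DE !fps2_scaleE !expr1n mulr1 mul1r.
have [a_odd|a_even] := boolP (odd a).
  have [b_odd|b_even] := boolP (odd b).
    by rewrite S_odd_odd // !mulr0 addr0 subr0.
  by rewrite -(signr_odd _ b) (negPf b_even) expr0; ring.
by rewrite -(signr_odd _ a) (negPf a_even) expr0; ring.
Qed.

Lemma parity_elimination :
  (p - pV) * (S - fps2_scale 1 (-1) S) = (q - qV) * (S - fps2_scale (-1) 1 S).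
Proof.
set S10 := fps2_scale (-1) 1 S; set S01 := fps2_scale 1 (-1) S.
have pVS : pV * S = q * (S10 + S01 - S).
  rewrite -flip_XY_eq {1}S_eq -[RHS]mul1r -ppV; ring.
have qVS : qV * S = p * (S10 + S01 - S).
  rewrite -flip_XY_eq {1}S_eq -[RHS]mul1r -qqV; ring.
have pVS01 : pV * S01 = qV * S10.
  rewrite /S01 flip_Y_eq -[RHS]mul1r -ppV; ring.
have qS01 : q * S01 = p * S10.
  rewrite /S01 flip_Y_eq -[RHS]mul1r -qqV; ring.
apply/eqP; rewrite -subr_eq0; apply/eqP.
transitivity (pV * S01 - qV * S10 - (pV * S - qV * S) - p * S01 + q * S10
  + (p - q) * S); first by ring.
rewrite pVS01 pVS qVS; transitivity (q * S01 * -1 + p * S10); first by ring.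
by rewrite qS01; ring.
Qed.

Lemma parity_symmetry a b :
  \sum_(l < a.+1) fps_exp c (2 * l).+1 * S (2 * (a - l))%N (2 * b).+1 =
  \sum_(l < b.+1) fps_exp c (2 * l).+1 * S (2 * a).+1 (2 * (b - l))%N.
Proof.
have sinh2_sum n (F : nat -> K) :
    \sum_(i < (2 * n).+2) fps_sinh2 c i * F ((2 * n).+1 - i)%N =
    2 * \sum_(l < n.+1) fps_exp c (2 * l).+1 * F (2 * (n - l))%N.
  rewrite (sum_even_odd (fun i => fps_sinh2 c i * F ((2 * n).+1 - i)%N)).
  rewrite mul2n /= uphalf_double doubleK -mul2n.
  rewrite big1 ?add0r ?mulr_sumr => [|l _]; last first.
    by rewrite fps_sinh2E oddM mul0r.
  apply: eq_bigr => l _; rewrite fps_sinh2E /= oddM /=.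
  by rewrite subSS -mulnBr /fps_exp !mulrA.
have S01E i : (S - fps2_scale 1 (-1) S) i (2 * b).+1 = 2 * S i (2 * b).+1.
  by rewrite fps2BE fps2_scaleE expr1n exprS exprM sqrrN !expr1n; ring.
have S10E j : (S - fps2_scale (-1) 1 S) (2 * a).+1 j = 2 * S (2 * a).+1 j.
  by rewrite fps2BE fps2_scaleE expr1n exprS exprM sqrrN !expr1n; ring.
have two_neq0 : 2 != 0 :> K by rewrite pnatr_eq0.
have := congr1 (fun F : fps2 K => F (2 * a).+1 (2 * b).+1) parity_elimination.
rewrite /p /q /pV /qV -!rmorphB in_XME in_YME.
rewrite (sinh2_sum a (fun i => (S - fps2_scale 1 (-1) S) i (2 * b).+1)).
rewrite (sinh2_sum b (fun j => (S - fps2_scale (-1) 1 S) (2 * a).+1 j)).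
under eq_bigr do rewrite S01E mulrCA.
under [in RHS]eq_bigr do rewrite S10E mulrCA.
by rewrite -!mulr_sumr => /(mulfI two_neq0)/(mulfI two_neq0).
Qed.

End ParityElimination.

Section WSymmetry.
Variable R : realType.
Implicit Types (a b : nat).
Local Open Scope complex_scope.

Local Notation Wc := (W_coef R).
Local Notation D := (sym_series Wc).

Lemma sym_series_conj : D = in_X (fps_exp (half_turn R)) *
  in_Y (fps_exp (half_turn R)) * conj_coefs D.
Proof.
have conj_Nlog : (- quarter_turn R)^*%C = quarter_turn R.
  by apply: complexP => /=; ring.
rewrite half_turnE; set l := quarter_turn R; rewrite !fps_expD !rmorphM /=.
set x := in_X (fps_exp l); set y := in_Y (fps_exp l).
pose xV := in_X (fps_exp (- l)); pose yV := in_Y (fps_exp (- l)).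
have xxV : x * xV = 1 by rewrite -rmorphM fps_expN rmorph1.
have yyV : y * yV = 1 by rewrite -rmorphM fps_expN rmorph1.
have real_D : x * y * conj_coefs D = xV * yV * D.
  have := conj_coefs_endpoint R; rewrite /endpoint_twist !rmorphM /=.
  by rewrite conj_coefs_in_X_exp conj_coefs_in_Y_exp conj_Nlog.
have -> : x * x * (y * y) * conj_coefs D = x * y * (x * y * conj_coefs D).
  by rewrite mulrACA; exact/esym/mulrA.
by rewrite real_D mulrA mulrACA xxV yyV !mul1r.
Qed.

(* Twice the sum of the real part of D in even total degree and of i times its
   imaginary part in odd total degree. *)
Definition parity_series : fps2 R[i] := D + fps2_scale (-1) (-1) (conj_coefs D).

Lemma parity_series_eq : parity_series = in_X (fps_exp (half_turn R)) *
  in_Y (fps_exp (half_turn R)) * fps2_scale (-1) (-1) parity_series.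
Proof.
set x := in_X _; set y := in_Y _.
have flip_D : fps2_scale (-1) (-1) (conj_coefs D) =
    x * y * fps2_scale (-1) (-1) D.
  have flip_conj F : fps2_scale (-1) (-1) (conj_coefs F) =
      conj_coefs (fps2_scale (-1) (-1) F) :> fps2 R[i].
    apply: fps2P => a b; rewrite fps2_scaleE !conj_coefsE fps2_scaleE.
    by rewrite !rmorphM !rmorphXn rmorphN1.
  have conj_Nhalf_turn : (- half_turn R)^*%C = half_turn R.
    by apply: complexP => /=; ring.
  have conj_coefsK F : conj_coefs (conj_coefs F) = F :> fps2 R[i].
    by apply: fps2P => a b; rewrite !conj_coefsE conjcK.
  rewrite [X in conj_coefs X]sym_series_conj flip_conj !rmorphM /=.
  rewrite fps2_scale_in_X fps2_scale_in_Y !fps_scale_exp !mulN1r.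
  rewrite conj_coefs_in_X_exp conj_coefs_in_Y_exp conj_Nhalf_turn.
  by rewrite -flip_conj conj_coefsK.
have -> : fps2_scale (-1) (-1) parity_series =
    fps2_scale (-1) (-1) D + conj_coefs D.
  apply: fps2P => a b; rewrite fps2_scaleE /parity_series !fps2DE !fps2_scaleE.
  rewrite mulrDr [X in _ + X = _]mulrA.
  by rewrite mulrACA -!expr2 !sqrr_sign !mul1r.
by rewrite /parity_series flip_D {1}sym_series_conj -/x -/y mulrDr addrC.
Qed.

Lemma parity_seriesE a b : parity_series a b =
  (1 + (-1) ^+ a) * ((- 'i%C) ^+ b * (Wc a b)%:C)
  + (1 + (-1) ^+ b) * ((- 'i%C) ^+ a * (Wc b a)%:C)
  - 2 * ((a == 0%N) && (b == 0%N))%:R.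
Proof.
have conj_term (x : R) n : (x%:C * (- 'i%C) ^+ n)^*%C =
    (-1) ^+ n * (x%:C * (- 'i%C) ^+ n) :> R[i].
  rewrite rmorphM rmorphXn mulrCA -exprMn mulN1r opprK.
  congr (_ * _ ^+ _); first exact: conjc_real.
  by apply: complexP; rewrite /= ?opprK ?oppr0.
have conj_sign n (z : R[i]) : ((-1) ^+ n * z)^*%C = (-1) ^+ n * z^*%C.
  by rewrite rmorphM rmorphXn rmorphN1.
have sign_sign n : (-1) ^+ n * (-1) ^+ n = 1 :> R[i].
  by rewrite -expr2 sqrr_sign.
have sign_delta : (-1) ^+ a * (-1) ^+ b * ((a == 0%N) && (b == 0%N))%:R =
    ((a == 0%N) && (b == 0%N))%:R :> R[i].
  by case: a b => [|a] [|b]; rewrite ?andbF ?mulr0 // !expr0 !mul1r.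
rewrite /parity_series fps2DE fps2_scaleE conj_coefsE /sym_series fps2BE fps2DE.
rewrite fps2_1E reflect_seriesE /depth_series rmorphB rmorphD rmorph_nat /=.
rewrite conj_sign conjcK !conj_term mulrBr sign_delta exprD.
set A := _%:C * _; set B := _%:C * _.
have := sign_sign a; have := sign_sign b.
move: ((-1) ^+ a) ((-1) ^+ b) (_%:R) => sa sb delta sb2 sa2.
transitivity (A + sa * sa * sb * B - delta
  + (sa * (sb * sb) * A + (sa * sa) * (sb * sb) * B - delta)); first by ring.
by rewrite sa2 sb2 /A /B; ring.
Qed.

Lemma parity_series_odd_odd a b : odd a -> odd b -> parity_series a b = 0.
Proof.
case: a b => [|a] [|b] // a_odd b_odd; rewrite parity_seriesE /=.
by rewrite -(signr_odd _ a.+1) a_odd -(signr_odd _ b.+1) b_odd expr1; ring.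
Qed.

Lemma parity_seriesC a b : parity_series a b = parity_series b a.
Proof. by rewrite !parity_seriesE andbC [X in X - _]addrC. Qed.

Lemma parity_series_even_odd a b : parity_series (2 * a)%N (2 * b).+1 =
  - 2 * 'i%C * ((-1) ^+ b * Wc (2 * a)%N (2 * b).+1)%:C.
Proof.
have even_sign n : (-1) ^+ (2 * n) = 1 :> R[i] by rewrite exprM sqrrN !expr1n.
rewrite parity_seriesE andbF mulr0 subr0 even_sign 2!exprS even_sign.
rewrite [_ ^+ (2 * b)]exprM sqrrN sqr_i rmorphM rmorphXn rmorphN1 /=.
by ring.
Qed.

Definition sinc_coef n : R := (-1) ^+ n * pi ^+ (2 * n) / (2 * n).+1`!%:R.

Lemma fps_exp_half_turn_odd n :
  fps_exp (half_turn R) (2 * n).+1 = half_turn R * (sinc_coef n)%:C.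
Proof.
rewrite /fps_exp /sinc_coef exprS exprM [_ ^+ 2]exprMn sqr_i -mulrA.
congr (_ * _).
by rewrite exprMn -exprM !rmorphM !rmorphXn fmorphV rmorph_nat rmorphN1.
Qed.

Lemma W_symmetry a b :
  (-1) ^+ b * \sum_(l < a.+1) sinc_coef l * Wc (2 * (a - l))%N (2 * b).+1 =
  (-1) ^+ a * \sum_(l < b.+1) sinc_coef l * Wc (2 * (b - l))%N (2 * a).+1.
Proof.
have side x y : \sum_(l < x.+1) fps_exp (half_turn R) (2 * l).+1 *
      parity_series (2 * (x - l))%N (2 * y).+1 =
    - (2 * 'i%C * half_turn R) * ((-1) ^+ y *
      \sum_(l < x.+1) sinc_coef l * Wc (2 * (x - l))%N (2 * y).+1)%:C.
  rewrite mulr_sumr rmorph_sum mulr_sumr; apply: eq_bigr => l _.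
  rewrite fps_exp_half_turn_odd parity_series_even_odd.
  by move: (sinc_coef l) (Wc _ _) => s w; rewrite !rmorphM /=; ring.
have := parity_symmetry parity_series_eq parity_series_odd_odd a b.
under [in RHS]eq_bigr do rewrite parity_seriesC.
rewrite !side => /mulfI/complexI; apply.
rewrite oppr_eq0 mulf_neq0 ?half_turn_neq0 // mulf_neq0 ?pnatr_eq0 //.
by rewrite eq_complex /= oner_eq0 andbF.
Qed.

End WSymmetry.

(** * Even values of the alternating zeta function *)

Section EtaRemainders.
Variable R : realType.
Implicit Types (t : R) (k n N : nat).

Definition cos_term k t : R := (-1) ^+ k * t ^+ (2 * k) / (2 * k)`!%:R.
Definition sin_term k t : R := (-1) ^+ k * t ^+ (2 * k).+1 / (2 * k).+1`!%:R.

Lemma is_derive_expn_fact n t :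
  is_derive t 1 (fun u : R => u ^+ n.+1 / n.+1`!%:R) (t ^+ n / n`!%:R).
Proof.
have -> : (fun u : R => u ^+ n.+1 / n.+1`!%:R) = n.+1`!%:R^-1 *: id ^+ n.+1.
  by apply: funext => u; rewrite !fctE mulrC.
apply: is_derive_eq (is_deriveZ _ (is_deriveX n.+1 (is_derive_id t 1))) _.
rewrite /GRing.scale /= mulr1 factS natrM.
have : n.+1%:R != 0 :> R by rewrite pnatr_eq0.
move: (n.+1%:R : R) => c c_neq0.
by field; rewrite c_neq0 natr_fact_neq0.
Qed.

Lemma is_derive_sin_term k t : is_derive t 1 (sin_term k) (cos_term k t).
Proof.
have -> : sin_term k =
    (fun u => (-1) ^+ k * (u ^+ (2 * k).+1 / (2 * k).+1`!%:R)).
  by apply: funext => u; rewrite mulrA.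
apply: is_derive_eq (is_deriveZ _ (is_derive_expn_fact _ _)) _.
by rewrite /GRing.scale /= mulrA.
Qed.

Lemma is_derive_cos_termS k t : is_derive t 1 (cos_term k.+1) (- sin_term k t).
Proof.
have -> : cos_term k.+1 =
    (fun u => (-1) ^+ k.+1 * (u ^+ (2 * k).+2 / (2 * k).+2`!%:R)).
  by apply: funext => u; rewrite /cos_term -mulrA mulnS.
apply: is_derive_eq (is_deriveZ _ (is_derive_expn_fact _ _)) _.
by rewrite /GRing.scale /= /sin_term exprS; ring.
Qed.

Lemma is_derive_cos_term0 t : is_derive t 1 (cos_term 0) 0.
Proof.
have -> : cos_term 0 = cst 1.
  by apply: funext => u; rewrite /cos_term muln0 !expr0 fact0 divr1 mulr1.
exact: is_derive_cst.
Qed.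

Lemma is_derive_bigsum n (f : 'I_n -> R -> R) (df : 'I_n -> R) t :
  (forall i, is_derive t 1 (f i) (df i)) ->
  is_derive t 1 (fun u => \sum_(i < n) f i u) (\sum_(i < n) df i).
Proof.
move=> f_der; have -> : (fun u => \sum_(i < n) f i u) = \sum_(i < n) f i.
  by apply: funext => u; rewrite fct_sumE.
exact: is_derive_sum.
Qed.

Lemma is_derive_linear (c t : R) : is_derive t 1 (fun u => c * u) c.
Proof.
by apply: is_derive_eq (is_deriveZ c (is_derive_id t 1)) _; exact: mulr1.
Qed.

Lemma is_derive_sin_scaled (c t : R) :
  is_derive t 1 (fun u => sin (c * u)) (c * cos (c * t)).
Proof.
apply: is_derive_eq (@is_derive1_comp _ sin (fun u => c * u) t _ _
  (is_derive_sin _) (is_derive_linear c t)) _.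
exact: mulrC.
Qed.

Lemma is_derive_cos_scaled (c t : R) :
  is_derive t 1 (fun u => cos (c * u)) (- c * sin (c * t)).
Proof.
apply: is_derive_eq (@is_derive1_comp _ cos (fun u => c * u) t _ _
  (is_derive_cos _) (is_derive_linear c t)) _.
by rewrite mulrC mulrN mulNr.
Qed.

(* The partial sums of the alternating zeta value at 2k, with the value 1/2 of
   the Abel sum at k = 0. *)
Definition eta_partial N k : R :=
  if k is 0%N then 2^-1 else \sum_(n < N) (-1) ^+ n / n.+1%:R ^+ (2 * k).

Definition cos_remainder N k t : R :=
  \sum_(n < N) (-1) ^+ n / n.+1%:R ^+ (2 * k) * cos (n.+1%:R * t)
  - \sum_(i < k.+1) eta_partial N i * cos_term (k - i) t.

Definition sin_remainder N k t : R :=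
  \sum_(n < N) (-1) ^+ n / n.+1%:R ^+ (2 * k).+1 * sin (n.+1%:R * t)
  - \sum_(i < k.+1) eta_partial N i * sin_term (k - i) t.

Lemma is_derive_sin_remainder N k t :
  is_derive t 1 (sin_remainder N k) (cos_remainder N k t).
Proof.
apply: is_derive_eq (is_deriveB
  (is_derive_bigsum (fun n : 'I_N =>
     is_deriveZ _ (is_derive_sin_scaled n.+1%:R t)))
  (is_derive_bigsum (fun i : 'I_k.+1 =>
     is_deriveZ _ (is_derive_sin_term (k - i) t)))) _.
congr (_ - _); apply: eq_bigr => n _ //; rewrite /GRing.scale /= exprSr invfM.
have : n.+1%:R != 0 :> R by rewrite pnatr_eq0.
by move: (n.+1%:R : R) (_ ^- (2 * k)) => c d c_neq0; field.
Qed.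

Lemma is_derive_cos_remainderS N k t :
  is_derive t 1 (cos_remainder N k.+1) (- sin_remainder N k t).
Proof.
have cos_term_der (i : 'I_k.+2) : is_derive t 1 (cos_term (k.+1 - i))
    (if (i <= k)%N then - sin_term (k - i) t else 0).
  have := ltn_ord i; rewrite ltnS leq_eqVlt ltnS => /orP[/eqP->|i_le].
    by rewrite subnn ltnn; exact: is_derive_cos_term0.
  by rewrite i_le subSn //; exact: is_derive_cos_termS.
apply: is_derive_eq (is_deriveB
  (is_derive_bigsum (fun n : 'I_N =>
     is_deriveZ _ (is_derive_cos_scaled n.+1%:R t)))
  (is_derive_bigsum (fun i : 'I_k.+2 => is_deriveZ _ (cos_term_der i)))) _.
rewrite big_ord_recr /= ltnn /GRing.scale /= mulr0 addr0 /sin_remainder.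
rewrite opprB addrC -!sumrN; congr (_ + _); apply: eq_bigr => n _.
  by rewrite -ltnS ltn_ord mulrN opprK.
rewrite (_ : (2 * k.+1 = (2 * k).+2)%N) ?mulnS // [_ ^+ _.+2]exprSr invfM.
have : n.+1%:R != 0 :> R by rewrite pnatr_eq0.
by move: (n.+1%:R : R) (_ ^- (2 * k).+1) => c d c_neq0; field.
Qed.

Lemma sin_remainder_at0 N k : sin_remainder N k 0 = 0.
Proof.
rewrite /sin_remainder [X in X - _]big1 => [|n _]; last first.
  by rewrite mulr0 sin0 mulr0.
rewrite big1 ?subrr // => i _.
by rewrite /sin_term expr0n /= mulr0 mul0r mulr0.
Qed.

Lemma cos_remainderS_at0 N k : cos_remainder N k.+1 0 = 0.
Proof.
rewrite /cos_remainder big_ord_recr /= subnn [X in _ - (X + _)]big1 => [|i _].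
  rewrite /cos_term muln0 !expr0 fact0 divr1 !mulr1 add0r.
  by under eq_bigr do rewrite mulr0 cos0 mulr1; rewrite subrr.
rewrite /cos_term expr0n muln_eq0 /= subn_eq0 leqNgt ltn_ord mulr0 mul0r.
exact: mulr0.
Qed.

Lemma dirichlet_kernel N t : 2 * cos (2^-1 * t) * cos_remainder N 0 t =
  - (-1) ^+ N * cos ((N%:R + 2^-1) * t).
Proof.
rewrite /cos_remainder big_ord1 /= /cos_term !muln0 !expr0 fact0 divr1 !mulr1.
under eq_bigr do rewrite expr0 divr1.
elim: N => [|N IH]; first by rewrite big_ord0 !add0r; field.
rewrite big_ord_recr /= addrAC mulrDr IH -(natr1 N).
rewrite (_ : (N%:R + 2^-1) * t = (N%:R + 1) * t - 2^-1 * t); last by field.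
rewrite (_ : (N%:R + 1 + 2^-1) * t = (N%:R + 1) * t + 2^-1 * t); last by field.
by rewrite cosB cosD exprS; ring.
Qed.

Lemma cos_half_ge t : 0 <= t <= pi / 2 -> 2^-1 <= cos (2^-1 * t).
Proof.
move=> t_quarter; have /andP[t_ge0 t_le] := t_quarter.
have half_quarter : 0 <= 2^-1 * t <= pi / 2 by apply/andP; split; lra.
have half_ge0 := quarter_cos_ge0 half_quarter.
have := quarter_cos_ge0 t_quarter.
rewrite [t in cos t](_ : t = (2^-1 * t) *+ 2); last by rewrite mulr2n; lra.
by rewrite cos_mulr2n mulr2n; have := cos_le1 (2^-1 * t); nra.
Qed.

Definition half_sec t : R := (2 * cos (2^-1 * t))^-1.
Definition dhalf_sec t : R := sin (2^-1 * t) * (2 * cos (2^-1 * t)) ^- 2.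

Lemma is_derive_half_sec t : 0 <= t <= pi / 2 ->
  is_derive t 1 half_sec (dhalf_sec t).
Proof.
move=> /cos_half_ge cos_ge; have cos_neq0 : 2 * cos (2^-1 * t) != 0.
  by rewrite gt_eqF //; lra.
apply: is_derive_eq (@is_deriveV _ (fun u => 2 * cos (2^-1 * u)) t _ 1 cos_neq0
  (is_deriveZ 2 (is_derive_cos_scaled 2^-1 t))) _.
by rewrite /GRing.scale /= /dhalf_sec; field; rewrite gt_eqF //; lra.
Qed.

Lemma half_sec_range t : 0 <= t <= pi / 2 -> 0 <= half_sec t <= 1.
Proof.
move=> /cos_half_ge cos_ge; have two_cos_ge : 1 <= 2 * cos (2^-1 * t) by lra.
by rewrite invr_ge0 (le_trans ler01) //= invf_le1 // (lt_le_trans ltr01).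
Qed.

Lemma dhalf_sec_ge0 t : 0 <= t <= pi / 2 -> 0 <= dhalf_sec t.
Proof.
move=> /andP[t_ge0 t_le]; rewrite mulr_ge0 ?invr_ge0 ?sqr_ge0 //.
by apply: quarter_sin_ge0; apply/andP; split; lra.
Qed.

(* Integration by parts of the kernel: the corrected remainder has the
   derivative sin ((N + 1/2) t) dhalf_sec t / (N + 1/2), up to sign. *)
Definition corrected_remainder N t : R := sin_remainder N 0 t
  + (-1) ^+ N / (N%:R + 2^-1) * (sin ((N%:R + 2^-1) * t) * half_sec t).

Lemma is_derive_corrected_remainder N t : 0 <= t <= pi / 2 ->
  is_derive t 1 (corrected_remainder N)
    ((-1) ^+ N / (N%:R + 2^-1) * (sin ((N%:R + 2^-1) * t) * dhalf_sec t)).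
Proof.
move=> t_quarter; set M : R := N%:R + 2^-1.
have M_neq0 : M != 0 by rewrite gt_eqF // ltr_wpDl ?invr_gt0.
apply: is_derive_eq (is_deriveD (is_derive_sin_remainder N 0 t)
  (is_deriveZ ((-1) ^+ N / M)
    (is_deriveM (is_derive_sin_scaled M t) (is_derive_half_sec t_quarter)))) _.
have -> : cos_remainder N 0 t = - (-1) ^+ N * cos (M * t) * half_sec t.
  rewrite -dirichlet_kernel /half_sec; field.
  by rewrite gt_eqF //; apply: lt_le_trans (cos_half_ge t_quarter).
by rewrite /GRing.scale /=; field.
Qed.

Lemma sin_remainder0_le N t : 0 <= t <= pi / 2 ->
  `|sin_remainder N 0 t| <= 2 / (N%:R + 2^-1).
Proof.
move=> t_quarter; have /andP[t_ge0 t_le] := t_quarter.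
set M : R := N%:R + 2^-1; have M_gt0 : 0 < M by rewrite ltr_wpDl ?invr_gt0.
have MV_ge0 : 0 <= M^-1 by rewrite invr_ge0 ltW.
have norm_sin x : `|sin x| <= 1 :> R by rewrite ler_norml sin_geN1 sin_le1.
have norm_osc u g : 0 <= g ->
    `|(-1) ^+ N / M * (sin (M * u) * g)| <= M^-1 * g.
  move=> g_ge0; rewrite !normrM normrX normrN1 expr1n mul1r (ger0_norm MV_ge0).
  by rewrite (ger0_norm g_ge0) ler_wpM2l // ler_piMl.
have corrected0 : corrected_remainder N 0 = 0.
  rewrite /corrected_remainder sin_remainder_at0 mulr0 sin0 mul0r mulr0.
  exact: addr0.
have corrected_le : `|corrected_remainder N t - corrected_remainder N 0| <=
    M^-1 * half_sec t - M^-1 * half_sec 0.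
  have quarter u : 0 <= u <= t -> 0 <= u <= pi / 2.
    by move=> /andP[-> /le_trans]; apply.
  apply: (@is_derive_normB_le _ _ _ (fun u => M^-1 * half_sec u)
    (fun u => M^-1 * dhalf_sec u) 0 t t_ge0
    (fun u u_le => is_derive_corrected_remainder N (quarter u u_le))) => u u_le.
    exact: (is_deriveZ M^-1 (is_derive_half_sec (quarter u u_le))).
  exact: norm_osc (dhalf_sec_ge0 (quarter u u_le)).
rewrite corrected0 subr0 in corrected_le.
have -> : sin_remainder N 0 t = corrected_remainder N t
    - (-1) ^+ N / M * (sin (M * t) * half_sec t) by rewrite addrK.
apply: le_trans (ler_normB _ _) _.
have /andP[sec_ge0 sec_le1] := half_sec_range t_quarter.
have /andP[sec0_ge0 _] : 0 <= half_sec (0 : R) <= 1.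
  by apply: half_sec_range; rewrite lexx divr_ge0 ?pi_ge0.
have := norm_osc t _ sec_ge0; have := mulr_ge0 MV_ge0 sec0_ge0.
by have := ler_wpM2l MV_ge0 sec_le1; lra.
Qed.

Lemma quarter_primitive_le (F dF : R -> R) (B : R) : 0 <= B -> F 0 = 0 ->
  (forall u : R, is_derive u 1 F (dF u)) ->
  (forall u, 0 <= u <= pi / 2 -> `|dF u| <= B) ->
  forall u, 0 <= u <= pi / 2 -> `|F u| <= 2 * B.
Proof.
move=> B_ge0 F0 F_der dF_le u /andP[u_ge0 u_le]; rewrite -[F u]subr0 -F0.
apply: (@le_trans _ _ (B * u - B * 0)).
  apply: (@is_derive_normB_le _ F dF (fun v => B * v) (fun=> B) 0 u u_ge0
    (fun v _ => F_der v)) => v /andP[v_ge0 v_le].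
    exact: is_derive_linear.
  by apply: dF_le; rewrite v_ge0 (le_trans v_le).
rewrite mulr0 subr0 mulrC ler_wpM2r //.
exact: le_trans u_le (ltW (@pihalf_lt2 R)).
Qed.

Lemma cos_remainderS_le N k (B : R) : 0 <= B ->
  (forall t, 0 <= t <= pi / 2 -> `|sin_remainder N k t| <= B) ->
  forall t, 0 <= t <= pi / 2 -> `|cos_remainder N k.+1 t| <= 2 * B.
Proof.
move=> B_ge0 sin_le; apply: (quarter_primitive_le B_ge0) => [|t|t t_quarter].
- exact: cos_remainderS_at0.
- exact: is_derive_cos_remainderS.
- by rewrite normrN sin_le.
Qed.

Lemma sin_remainder_le N k t : 0 <= t <= pi / 2 ->
  `|sin_remainder N k t| <= 2 ^+ (2 * k).+1 / (N%:R + 2^-1).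
Proof.
have M_ge0 : 0 <= N%:R + 2^-1 :> R by rewrite addr_ge0.
have pow2_ge0 n : 0 <= 2 ^+ n / (N%:R + 2^-1) :> R.
  by rewrite divr_ge0 ?exprn_ge0.
elim: k t => [|k IH] t t_quarter; first exact: sin_remainder0_le.
rewrite mulnS addSn add1n exprS -mulrA.
apply: (@quarter_primitive_le _ (cos_remainder N k.+1)) => //.
- exact: sin_remainder_at0.
- by move=> u; exact: is_derive_sin_remainder.
- by rewrite exprS -mulrA; exact: cos_remainderS_le.
Qed.

Lemma cos_remainder_le N k t : 0 <= t <= pi / 2 ->
  `|cos_remainder N k.+1 t| <= 2 ^+ (2 * k).+2 / (N%:R + 2^-1).
Proof.
rewrite exprS -mulrA; move: t; apply: cos_remainderS_le; last first.
  exact: sin_remainder_le.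
by rewrite divr_ge0 ?exprn_ge0 ?addr_ge0.
Qed.

End EtaRemainders.

Section ZetaRecursion.
Variable R : realType.
Implicit Types (k n N : nat).
Local Open Scope classical_set_scope.

Local Notation zb := (zetabar R).

Lemma zetabar_cvg s : (0 < s)%N ->
  (\sum_(n < N) (-1) ^+ n / n.+1%:R ^+ s : R) @[N --> \oo] --> zb s.
Proof.
case: s => // s _.
pose u n : R := (n.+1%:R ^+ s.+1)^-1.
have u_cvg0 : u n @[n --> \oo] --> 0.
  apply: (@squeeze_cvgr _ _ _ _ (fun=> 0) harmonic); last exact: cvg_harmonic.
    near=> n; rewrite invr_ge0 exprn_ge0 //=.
    rewrite lef_pV2 ?posrE ?exprn_gt0 ?ltr0n //.
    by rewrite exprS ler_peMr ?ler0n // exprn_ege1 // ler1n.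
  exact: cvg_cst.
have : cvgn (fun N => \sum_(n < N) (-1) ^+ n * (u n * 1)).
  apply: (@alternating_cvg_mul _ u (fun=> 1) 0) => [n|n|N|].
  - rewrite invr_ge0 exprn_ge0 //= lef_pV2 ?posrE ?exprn_gt0 ?ltr0n //.
    by rewrite lerXn2r ?nnegrE ?ler0n // ler_nat.
  - by rewrite ler01 lexx.
  - by rewrite big1 // => n _; rewrite subrr mulr0.
  - by under eq_fun do rewrite mulr1.
under eq_fun do under eq_bigr do rewrite mulr1.
rewrite /zetabar.
by under [X in _ -> _ --> limn X]eq_fun do rewrite big_add1 big_mkord.
Unshelve. all: by end_near. Qed.

Lemma eta_partial_cvg k : eta_partial R N k @[N --> \oo] --> zb (2 * k)%N.
Proof. by case: k => [|k]; [exact: cvg_cst|exact: zetabar_cvg]. Qed.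

Lemma sum_cos_natpihalf k N :
  \sum_(n < 2 * N) (-1) ^+ n / n.+1%:R ^+ (2 * k) * cos (n.+1%:R * (pi / 2)) =
  (2 ^+ (2 * k))^-1 * \sum_(m < N) (-1) ^+ m / m.+1%:R ^+ (2 * k) :> R.
Proof.
rewrite (sum_even_odd (fun n =>
  (-1) ^+ n / n.+1%:R ^+ (2 * k) * cos (n.+1%:R * (pi / 2)) : R)).
rewrite mul2n uphalf_double doubleK big1 ?add0r => [|m _]; last first.
  rewrite (_ : _ * (pi / 2) = pi / 2 + pi *+ m :> R); last first.
    by rewrite -natr1 natrM -mulr_natr; field.
  by rewrite (alternatingn (@cosDpi R)) cos_pihalf !mulr0.
rewrite mulr_sumr; apply: eq_bigr => m _.
rewrite (_ : (2 * m).+2 = 2 * m.+1)%N; last by rewrite mulnS.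
rewrite natrM.
rewrite (_ : 2 * m.+1%:R * (pi / 2) = 0 + pi *+ m.+1 :> R); last first.
  by rewrite -mulr_natr; field.
rewrite (alternatingn (@cosDpi R)) cos0 exprMn invfM !exprS exprM sqrrN !expr1n.
by ring.
Qed.

Lemma cos_remainder_cvg0 k (t : R) : 0 <= t <= pi / 2 ->
  cos_remainder N k.+1 t @[N --> \oo] --> 0.
Proof.
move=> t_quarter; pose B : R := 2 ^+ (2 * k).+2 * 2.
apply: norm_cvg0.
apply: (@squeeze_cvgr _ _ _ _ (fun=> 0) (fun N => B * harmonic N)).
- near=> N; rewrite normr_ge0 (le_trans (cos_remainder_le N k t_quarter)) //.
  rewrite /B /harmonic /= -mulrA ler_wpM2l ?exprn_ge0 // -[leRHS]invf_div.
  rewrite lef_pV2 ?posrE ?divr_gt0 ?ltr0n // ?ltr_wpDl ?invr_gt0 // -natr1.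
  by have : 0 <= N%:R :> R by []; lra.
- exact: cvg_cst.
- by rewrite -[X in _ --> X](mulr0 B); apply: cvgMl_tmp; exact: cvg_harmonic.
Unshelve. all: by end_near. Qed.

Lemma zetabar_cos k :
  \sum_(i < k.+1) zb (2 * i)%N * cos_term (k - i) (pi / 2) =
  (2 ^+ (2 * k))^-1 * zb (2 * k)%N.
Proof.
case: k => [|k].
  rewrite big_ord1 /cos_term !muln0 !expr0 fact0 divr1 invr1 !mulr1.
  by rewrite mul1r.
pose zeta_sum N := (2 ^+ (2 * k.+1))^-1 * eta_partial R N k.+1
  - \sum_(i < k.+2) eta_partial R (2 * N) i * cos_term (k.+1 - i) (pi / 2).
have sum_cvg : zeta_sum N @[N --> \oo] -->
    (2 ^+ (2 * k.+1))^-1 * zb (2 * k.+1)%N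
    - \sum_(i < k.+2) zb (2 * i)%N * cos_term (k.+1 - i) (pi / 2).
  apply: cvgB; first by apply: cvgMl_tmp; exact: eta_partial_cvg.
  apply: cvg_big => [|i _]; first exact: add_continuous.
  apply: cvgMr_tmp.
  apply: (@cvg_comp _ _ _ (muln 2) (eta_partial R ^~ i)).
    exact: cvg_mulnl.
  exact: eta_partial_cvg.
have sum_cvg0 : zeta_sum N @[N --> \oo] --> 0.
  have -> : zeta_sum = (fun N => cos_remainder N k.+1 (pi / 2)) \o muln 2.
    by apply: funext => N; rewrite /= /cos_remainder sum_cos_natpihalf.
  apply: (@cvg_comp _ _ _ (muln 2) (fun N => cos_remainder N k.+1 (pi / 2))).
    exact: cvg_mulnl.
  by apply: cos_remainder_cvg0; rewrite lexx divr_ge0 ?pi_ge0.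
apply/eqP; rewrite eq_sym -subr_eq0; apply/eqP.
by rewrite -(cvg_lim _ sum_cvg) // (cvg_lim _ sum_cvg0).
Qed.

Local Open Scope complex_scope.

Definition zeta_fps : fps R[i] := fun n => if odd n then 0 else (zb n)%:C.

Lemma zeta_fps_mulE (F : fps R[i]) n : (zeta_fps * F : fps R[i]) n =
  \sum_(i < n./2.+1) (zb (2 * i)%N)%:C * F (n - 2 * i)%N.
Proof.
rewrite fpsME (sum_even_odd (fun i => zeta_fps i * F (n - i)%N)) /=.
rewrite [X in _ + X]big1 ?addr0 => [|i _]; last first.
  by rewrite /zeta_fps /= oddM mul0r.
by apply: eq_bigr => i _; rewrite /zeta_fps oddM.
Qed.

Lemma fps_exp_quarter_turn_even k :
  fps_exp (quarter_turn R) (2 * k)%N = (cos_term k (pi / 2))%:C.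
Proof.
rewrite /fps_exp exprMn exprM sqr_i -rmorphXn /cos_term.
by rewrite !rmorphM !rmorphXn rmorphN1 fmorphV rmorph_nat.
Qed.

Lemma zeta_mul_cosh2 : zeta_fps * fps_cosh2 (quarter_turn R) =
  fps_scale 2^-1 zeta_fps *+ 2.
Proof.
apply: funext => n; rewrite zeta_fps_mulE mulr2n fpsDE /fps_scale /zeta_fps.
have [n_odd|n_even] := boolP (odd n).
  rewrite !mulr0 addr0 big1 // => i _.
  have i_le : (2 * i <= n)%N by have := ltn_ord i; lia.
  by rewrite fps_cosh2E oddB // n_odd oddM mulr0.
rewrite -(even_halfK n_even) doubleK -mul2n; move: (n./2) => k.
transitivity
  (2 * (\sum_(i < k.+1) zb (2 * i)%N * cos_term (k - i) (pi / 2))%:C).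
  rewrite rmorph_sum mulr_sumr; apply: eq_bigr => i _.
  rewrite -mulnBr fps_cosh2E oddM /=.
  by rewrite fps_exp_quarter_turn_even mulrCA -rmorphM.
rewrite zetabar_cos rmorphM fmorphV rmorphXn rmorph_nat exprVn.
by ring.
Qed.

Lemma zeta_mul_sinh2 :
  zeta_fps * fps_sinh2 (half_turn R) =
  fps_scale 2^-1 (zeta_fps * fps_sinh2 (half_turn R)) *+ 2.
Proof.
rewrite rmorphM /= fps_scale_sinh2.
have -> : 2^-1 * half_turn R = quarter_turn R by rewrite half_turnE; field.
rewrite half_turnE.
by rewrite fps_sinh2_double mulrCA zeta_mul_cosh2 mulrnAr mulrC.
Qed.

Lemma zetabar_sinc d :
  \sum_(i < d.+2) zb (2 * i)%N * sinc_coef R (d.+1 - i) = 0.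
Proof.
have coef0 : (zeta_fps * fps_sinh2 (half_turn R)) (2 * d.+1).+1 = 0.
  have := congr1 (fun F : fps R[i] => F (2 * d.+1).+1) zeta_mul_sinh2.
  rewrite mulr2n fpsDE /fps_scale exprS.
  move: (_ (2 * d.+1).+1) => v v_eq; apply/eqP.
  have pow_lt1 : 2^-1 ^+ (2 * d.+1) < 1 :> R[i].
    by rewrite exprn_ilt1 ?invf_lt1 ?invr_ge0 ?ltr1n.
  have : (1 - 2^-1 ^+ (2 * d.+1)) * v = 0.
    by rewrite mulrBl mul1r {1}v_eq; field.
  by move/eqP; rewrite mulf_eq0 subr_eq0 eq_sym lt_eqF.
apply: complexI; rewrite rmorph_sum /=.
have factor_neq0 : 2 * half_turn R != 0.
  by rewrite mulf_neq0 ?pnatr_eq0 ?half_turn_neq0.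
apply: (mulfI factor_neq0); rewrite mulr0 -[RHS]coef0 zeta_fps_mulE mulr_sumr.
rewrite mul2n /= uphalf_double -mul2n; apply: eq_bigr => i _.
rewrite [(_.+1 - 2 * _)%N]subSn; last by have := ltn_ord i; lia.
rewrite -mulnBr fps_sinh2E /= oddM /= fps_exp_half_turn_odd.
by rewrite rmorphM /=; ring.
Qed.

End ZetaRecursion.

(** * The numbers Z(j,p) *)

Section ZCoefficients.
Variable R : realType.
Implicit Types (j k p n : nat).
Local Notation zb := (zetabar R).

Fixpoint chains_between k j p : seq (seq nat) :=
  if k is k'.+1 then
    [seq i :: s | i <- iota j.+1 (p - j), s <- chains_between k' i p]
  else if j == p then [:: [::]] else [::].

Lemma chains_between_uniq k j p : uniq (chains_between k j p).
Proof.
elim: k j => [|k IH] j /=; first by case: ifP.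
by apply: uniq_allpairs_cons => //; exact: iota_uniq.
Qed.

Lemma mem_chains_between k j p s : (s \in chains_between k j p) =
  [&& size s == k, all (fun x => (x < p.+1)%N) s &
      sorted ltn (j :: s) && (last j s == p)].
Proof.
elim: k j s => [|k IH] j s /=.
  by case: s => [|x s] /=; case: ifP => // _; rewrite ?inE // in_nil.
apply/allpairsPdep/and3P => [[i [s' [i_range]]]|].
  rewrite IH => /and3P[/eqP size_s' s'_lt /andP[path_s' last_s']] ->.
  rewrite mem_iota in i_range; move: path_s' => /= path_s'.
  by rewrite /= size_s' s'_lt last_s' path_s'; split=> //; lia.
case: s => [[]//|i s] /=.
move=> [size_s /andP[i_lt s_lt] /andP[/andP[j_lt path_s] last_s]].
exists i, s; split=> //; first by rewrite mem_iota; lia.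
by rewrite IH -eqSS size_s s_lt /= path_s last_s.
Qed.

Definition Z_depth k j p : R :=
  \sum_(s <- chains_between k j p) \prod_(l < k)
    (-2 * zb (2 * nth 0 (j :: s) l.+1 - 2 * nth 0 (j :: s) l)%N).

Lemma Z_depth0 j p : Z_depth 0 j p = (j == p)%:R.
Proof.
by rewrite /Z_depth /=; case: eqP; rewrite ?big_seq1 ?big_ord0 ?big_nil.
Qed.

Lemma Z_depthS k j p : Z_depth k.+1 j p =
  \sum_(i < p - j) (-2 * zb (2 * i.+1)%N) * Z_depth k (j + i.+1) p.
Proof.
rewrite /Z_depth [LHS]big_allpairs_dep /= -(addn0 j.+1) iotaDl big_map.
rewrite -[X in iota 0 X]subn0 big_mkord; apply: eq_bigr => i _.
rewrite mulr_sumr addSnnS; apply: eq_bigr => s _; rewrite big_ord_recl /=.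
by rewrite mulnDr addnC addnK.
Qed.

Lemma Z_depth_small k j p : (p - j < k)%N -> Z_depth k j p = 0.
Proof.
elim: k j => // k IH j j_lt; rewrite Z_depthS big1 // => i _.
by rewrite IH ?mulr0 //; have := ltn_ord i; lia.
Qed.

Lemma Z_sum_depth j p n : (j <= p)%N -> (p - j < n)%N ->
  Z R j p = \sum_(k < n) Z_depth k j p.
Proof.
move=> j_le; case: n => // n n_gt; rewrite big_ord_recl Z_depth0 /Z.
have [->|j_neq] := eqVneq j p.
  by rewrite big1 ?addr0 // => i _; rewrite Z_depth_small // subnn.
rewrite add0r big_add1 big_mkord.
have -> : n = (p - j + (n - (p - j)))%N by lia.
rewrite [RHS]big_split_ord [X in _ = _ + X]big1 ?addr0; last first.
  by move=> i _; rewrite Z_depth_small // /= /bump /=; lia.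
apply: eq_bigr => k _; rewrite (@sum_tuple_enum _ _ _
  (fun s => sorted ltn (j :: s) && (last j s == p)) (chains_between k.+1 j p)
  (fun s => \prod_(l < k.+1)
     zb (2 * nth 0 (j :: s) l.+1 - 2 * nth 0 (j :: s) l)%N)
  (chains_between_uniq _ _ _)); last by move=> s; rewrite mem_chains_between.
rewrite mulr_sumr; apply: eq_bigr => s _.
by rewrite big_split /= prodr_const card_ord.
Qed.

Lemma Z_diag p : Z R p p = 1. Proof. by rewrite /Z eqxx. Qed.

Lemma Z_recursion j p : (j < p)%N ->
  Z R j p = \sum_(i < p - j) (-2 * zb (2 * i.+1)%N) * Z R (j + i.+1) p.
Proof.
move=> j_lt; rewrite (@Z_sum_depth j p (p - j).+1) ?(ltnW j_lt) //.
rewrite big_ord_recl Z_depth0 ltn_eqF // add0r.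
under eq_bigr do rewrite lift0 Z_depthS.
rewrite exchange_big; apply: eq_bigr => i _; rewrite -mulr_sumr.
by congr (_ * _); rewrite -Z_sum_depth //; have := ltn_ord i; lia.
Qed.

Lemma Z_sinc_coef j p : (j <= p)%N -> Z R j p = sinc_coef R (p - j).
Proof.
move=> j_le; move e : (p - j)%N => d.
elim/ltn_ind: d j j_le e => -[|d] IH j j_le e.
  have -> : j = p by lia.
  by rewrite Z_diag /sinc_coef muln0 !expr0 divr1 mulr1.
rewrite Z_recursion ?e; last by lia.
have sum0 := zetabar_sinc R d; rewrite big_ord_recl /= subn0 in sum0.
transitivity (-2 * \sum_(i < d.+1) zb (2 * i.+1)%N * sinc_coef R (d - i)).
  rewrite mulr_sumr; apply: eq_bigr => i _; rewrite -mulrA; congr (_ * (_ * _)).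
  by apply: IH; have := ltn_ord i; lia.
have -> : \sum_(i < d.+1) zb (2 * i.+1)%N * sinc_coef R (d - i) =
    - (2^-1 * sinc_coef R d.+1).
  by apply/eqP; rewrite -addr_eq0 addrC; apply/eqP; exact: sum0.
by field.
Qed.

End ZCoefficients.

Lemma W_Z_sum (R : realType) (m p : nat) :
  \sum_(1 <= j < p.+2) W R (2 * j + 2 * m.+1 - 3) (2 * m.+1 - 1) * Z R j p.+1 =
  \sum_(l < p.+1) sinc_coef R l * W_coef R (2 * (p - l)) (2 * m).+1.
Proof.
rewrite big_add1 big_mkord /= (reindex_inj rev_ord_inj); apply: eq_bigr => l _.
have l_lt : (l < p.+1)%N := ltn_ord l.
rewrite /= subSS Z_sinc_coef ?ltnS ?leq_subr // mulrC.
by congr (sinc_coef R _ * W R _ _); lia.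
Qed.

Unset Implicit Arguments.

Theorem theorem1p2 (R : realType) (m p : nat) (hm : (0 < m)%N) (hp : (0 < p)%N) :
  (-1) ^+ m * \sum_(1 <= j < p.+1) W R (2 * j + 2 * m - 3) (2 * m - 1) * Z R j p
  = (-1) ^+ p * \sum_(1 <= j < m.+1) W R (2 * j + 2 * p - 3) (2 * p - 1) * Z R j m.
Proof.
case: m hm => // b _; case: p hp => // a _.
by rewrite !W_Z_sum !exprS -!mulrA W_symmetry.
Qed.
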